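(* Let $\Sigma$ be an entire spacelike hypersurface in $\mathbb R^{3,1}$ with scalar curvature bounded above by a negative constant. Then, up to a time-reversing isometry (i.e. possibly after replacing $\Sigma$ by its image under a time-reversing isometry of $\mathbb R^{3,1}$), $\mathcal D(\Sigma)=\mathcal D_\varphi$ for some lower semi-continuous function $\varphi:\mathbb S^2\to\mathbb R\cup\{+\infty\}$ with $\mathrm{card}(F_\varphi)\ge 3$.
   Context: $\mathbb R^{n,1}$ is $\mathbb R^{n+1}$ with the metric $dx_1^2+\dots+dx_n^2-dx_{n+1}^2$ (here $n=3$). An entire spacelike hypersurface is the graph of a smooth function $u:\mathbb R^n\to\mathbb R$ with $|Du|<1$ everywhere; its scalar curvature is that of its induced Riemannian metric. An inextensible causal curve is a curve $\{(f(t),t):t\in\mathbb R\}$ with $f:\mathbb R\to\mathbb R^n$ smooth and $|f'|\le1$. The domain of dependence $\mathcal D(\Sigma)$ is the set of $p\in\mathbb R^{n,1}$ such that every inextensible causal curve containing $p$ intersects $\Sigma$. For lower semi-continuous $\varphi:\mathbb S^{n-1}\to\mathbb R\cup\{+\infty\}$, let $F_\varphi=\{\varphi<+\infty\}$, $V_\varphi(x)=\sup_{y\in F_\varphi}(\langle x,y\rangle-\varphi(y))$ and $\mathcal D_\varphi=\{(x,x_{n+1}): x_{n+1}>V_\varphi(x)\}$. *)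

(* Defs.v *)
From mathcomp Require Import all_boot all_order all_algebra.
From mathcomp Require Import all_classical all_reals all_analysis.

Set Implicit Arguments.
Unset Strict Implicit.
Unset Printing Implicit Defensive.

Import Order.TTheory GRing.Theory Num.Theory.
Import numFieldNormedType.Exports.

Local Open Scope classical_set_scope.
Local Open Scope ring_scope.

Section Smooth.
Context {R : realType} {V W : normedModType R}.

(* The directional derivatives are taken for all directions and each iterate
   is required to be Frechet differentiable, so in finite dimension this is
   the usual class C^k. *)
Fixpoint is_Ck (k : nat) (f : V -> W) : Prop :=
  if k is k'.+1 then
    (forall x, differentiable f x) /\ (forall v, is_Ck k' ('D_v f))
  else continuous f.

Definition smooth (f : V -> W) : Prop := forall k, is_Ck k f.

End Smooth.

Section Euclidean.
Context {R : realType} {n : nat}.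

Definition dot (x y : 'rV[R]_n) : R := \sum_(i < n) x 0 i * y 0 i.

(* The library norm on 'rV[R]_n is the sup norm, not the Euclidean one. *)
Definition enorm (x : 'rV[R]_n) : R := Num.sqrt (dot x x).

Definition partial (i : 'I_n) (f : 'rV[R]_n -> R) (x : 'rV[R]_n) : R :=
  'D_('e_i) f x.

Definition gradient (f : 'rV[R]_n -> R) (x : 'rV[R]_n) : 'rV[R]_n :=
  \row_(i < n) partial i f x.

End Euclidean.

Definition sphere (R : realType) (n : nat) : set 'rV[R]_n :=
  [set y | enorm y = 1].
Arguments sphere : clear implicits.

(* R^{n,1}: the second component is the timelike coordinate x_{n+1}. *)
Notation mink_space R n := ('rV[R]_n * R)%type.

Section Curvature.
Context {R : realType} {n : nat}.
Variable g : 'rV[R]_n -> 'M[R]_n.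

Definition christoffel (k i j : 'I_n) (x : 'rV[R]_n) : R :=
  2^-1 * \sum_(l < n) invmx (g x) k l *
    (partial i (fun y => g y j l) x + partial j (fun y => g y i l) x
     - partial l (fun y => g y i j) x).

(* riemann l k i j is the coefficient R^l_{kij} in
   R(d_i, d_j) d_k = R^l_{kij} d_l, with
   R(X, Y) = nabla_X nabla_Y - nabla_Y nabla_X - nabla_[X, Y];
   with this sign round spheres have positive scalar curvature. *)
Definition riemann (l k i j : 'I_n) (x : 'rV[R]_n) : R :=
  partial i (christoffel l j k) x - partial j (christoffel l i k) x
  + \sum_(m < n) (christoffel l i m x * christoffel m j k x
                  - christoffel l j m x * christoffel m i k x).

Definition ricci (j k : 'I_n) (x : 'rV[R]_n) : R :=
  \sum_(i < n) riemann i k i j x.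

Definition scalar_curvature (x : 'rV[R]_n) : R :=
  \sum_(j < n) \sum_(k < n) invmx (g x) j k * ricci j k x.

End Curvature.

Section Minkowski.
Context {R : realType} {n : nat}.

Definition mink (p q : mink_space R n) : R := dot p.1 q.1 - p.2 * q.2.

Definition graph_map (u : 'rV[R]_n -> R) (x : 'rV[R]_n) : mink_space R n :=
  (x, u x).

Definition graph (u : 'rV[R]_n -> R) : set (mink_space R n) :=
  range (graph_map u).

Definition entire_spacelike (u : 'rV[R]_n -> R) : Prop :=
  smooth u /\ forall x, enorm (gradient u x) < 1.

(* Induced metric on the graph of u, in the global chart x |-> (x, u x). *)
Definition induced_metric (u : 'rV[R]_n -> R) (x : 'rV[R]_n) : 'M[R]_n :=
  \matrix_(i < n, j < n) mink ('D_('e_i) (graph_map u) x)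
                              ('D_('e_j) (graph_map u) x).

Definition causal_curve (f : R -> 'rV[R]_n) : Prop :=
  smooth f /\ forall t, enorm ('D_1 f t) <= 1.

Definition domain_of_dependence (S : set (mink_space R n)) :
    set (mink_space R n) :=
  [set p | forall f : R -> 'rV[R]_n, causal_curve f ->
     (exists t, (f t, t) = p) -> exists t, S (f t, t)].

Definition mink_isometry (Phi : mink_space R n -> mink_space R n) : Prop :=
  [/\ smooth Phi,
      exists Psi : mink_space R n -> mink_space R n,
        [/\ smooth Psi, cancel Phi Psi & cancel Psi Phi]
    & forall p v w, mink ('D_v Phi p) ('D_w Phi p) = mink v w].

(* The differential sends future-directed timelike vectors to past-directed
   ones. *)
Definition time_reversing (Phi : mink_space R n -> mink_space R n) : Prop :=
  forall p v, mink v v < 0 -> 0 < v.2 -> ('D_v Phi p).2 < 0.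

(* In the next three definitions the values of phi are meant to lie in
   R U {+oo}; this is a hypothesis on phi wherever they are used. *)
Definition finite_locus (phi : sphere R n -> \bar R) : set (sphere R n) :=
  [set y | (phi y < +oo)%E].

Definition support_fun (phi : sphere R n -> \bar R) (x : 'rV[R]_n) : \bar R :=
  ereal_sup [set ((dot x (set_val y))%:E - phi y)%E | y in finite_locus phi].

Definition regular_domain (phi : sphere R n -> \bar R) :
    set (mink_space R n) :=
  [set p | (support_fun phi p.1 < p.2%:E)%E].

End Minkowski.

(* Main.v *)
Require Import Defs.
From mathcomp Require Import all_boot all_order all_algebra.
From mathcomp Require Import all_classical all_reals all_analysis.
From mathcomp Require Import ring lra.
Import Order.TTheory GRing.Theory Num.Theory.
Import numFieldNormedType.Exports.
Local Open Scope classical_set_scope.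
Local Open Scope card_scope.
Local Open Scope ring_scope.


(** Write [A] for the shape operator of the graph of [u] and [S2] for the second
    symmetric function of its principal curvatures. By the Gauss equation
    ([scalar_curvature_graph]) the scalar curvature is [- 2 * S2], so the
    hypothesis says that [S2] is bounded below by a positive constant. Then the
    mean curvature has no zero; reversing time if necessary, it is positive
    ([curvature_bound_or_opp]).

    For any entire spacelike graph, the points below the graph that do not
    belong to the domain of dependence are those that lie on or below a null
    hyperplane [t = dot z y - b] that is itself below the graph: a causal curve
    that escapes to infinity without meeting the graph selects such a hyperplane
    by compactness of the sphere of null directions
    ([null_support_of_unbounded]). Hence [phi] is the Legendre transform of [u]
    restricted to the sphere, provided that no null hyperplane lies above the
    graph ([domain_of_dependence_graph]). Such a hyperplane would be parallel to
    all those below the graph, so everything follows once the set [F] of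
    directions [y] with [phi y < +oo] has three elements.

    Suppose that [F] is contained in [{y1, y2}]. The tool is a comparison with
    quadrics ([barrier_max_le]). Let [l1], [l2] be the two null coordinates
    [t - dot w yi] of a vector [(w, t)] based at some origin, and let
    [Q = t ^+ 2 - dot w w]. At a positive maximum on the graph of
    [(1 - e) * 2 / (1 - dot y1 y2) * (l1 * l2) + e * Q], for [0 < e <= 1], the
    graph touches from below a level set with one principal curvature of order
    one and two of order [e]. As [S2] is monotone on the cone where the mean
    curvature and [S2] are positive, the maximum is at most a constant times
    [e]. This is used twice.

    With [e = 1] it gives the bound of Hawking's singularity theorem: for an
    origin in the past part of the domain of dependence, the proper time to the
    graph is bounded ([proper_time2_bound]). If [y2] is not in [F], the origin
    can be moved arbitrarily far along [- (y2, 1)] without leaving the domain,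
    and the proper time to a fixed point of the graph tends to infinity; so
    both [y1] and [y2] are in [F] ([null_direction_of_only]). Then the graph
    lies in the wedge bounded by two null hyperplanes, at bounded distance from
    its edge ([gap_product_bound]).

    With small [e] and an origin slightly inside the wedge, the distance bound
    makes the region where the function is large compact, so that a maximum
    exists; its value stays bounded below as [e] tends to zero, which is a
    contradiction ([no_wedge]). Geometrically, a wedge admits only surfaces that
    look like a hyperbola times a plane, for which [S2] vanishes. *)

Set Implicit Arguments.
Unset Strict Implicit.
Unset Printing Implicit Defensive.

(** * The Euclidean inner product *)

Section InnerProduct.
Context {R : realType} {n : nat}.
Implicit Types (x y z : 'rV[R]_n) (k : R).

Lemma dotC x y : dot x y = dot y x.
Proof. by apply: eq_bigr => i _; rewrite mulrC. Qed.

Lemma dotDl x y z : dot (x + y) z = dot x z + dot y z.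
Proof. by rewrite -big_split; apply: eq_bigr => i _; rewrite mxE mulrDl. Qed.

Lemma dotZl k x y : dot (k *: x) y = k * dot x y.
Proof. by rewrite mulr_sumr; apply: eq_bigr => i _; rewrite mxE mulrA. Qed.

Lemma dotDr x y z : dot z (x + y) = dot z x + dot z y.
Proof. by rewrite dotC dotDl !(dotC _ z). Qed.

Lemma dotZr k x y : dot x (k *: y) = k * dot x y.
Proof. by rewrite dotC dotZl dotC. Qed.

Lemma dotNl x y : dot (- x) y = - dot x y.
Proof. by rewrite -scaleN1r dotZl mulN1r. Qed.

Lemma dotNr x y : dot x (- y) = - dot x y.
Proof. by rewrite dotC dotNl dotC. Qed.

Lemma dot0l x : dot 0 x = 0.
Proof. by rewrite -(scale0r (0 : 'rV[R]_n)) dotZl mul0r. Qed.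

Lemma dot0r x : dot x 0 = 0.
Proof. by rewrite dotC dot0l. Qed.

Definition dotE := (dotDl, dotDr, dotNl, dotNr, dotZl, dotZr).

Lemma dot_ge0 x : 0 <= dot x x.
Proof. by apply: sumr_ge0 => i _; rewrite -expr2 sqr_ge0. Qed.

Lemma dot_eq0 x : dot x x = 0 -> x = 0.
Proof.
move=> /eqP; rewrite psumr_eq0 => [/allP h|i _]; last by rewrite -expr2 sqr_ge0.
apply/rowP => i; rewrite !mxE.
by have := h i (mem_index_enum _); rewrite /= -expr2 sqrf_eq0 => /eqP.
Qed.

Lemma dot_gt0 x : x != 0 -> 0 < dot x x.
Proof.
by move=> x0; rewrite lt_def dot_ge0 andbT; apply: contra_neq x0 => /dot_eq0.
Qed.

Lemma dot_cauchy_schwarz x y : dot x y ^+ 2 <= dot x x * dot y y.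
Proof.
have [->|y0] := eqVneq y 0; first by rewrite !dot0r mulr0 expr2 mulr0.
have := dot_ge0 (dot y y *: x - dot x y *: y).
rewrite !dotE (dotC y x) => h.
have yy := dot_gt0 y0.
rewrite -subr_ge0 -(pmulr_rge0 _ yy); apply: le_trans h _.
by rewrite le_eqVlt; apply/orP; left; apply/eqP; ring.
Qed.

Lemma enorm_sqr x : enorm x ^+ 2 = dot x x.
Proof. by rewrite sqr_sqrtr ?dot_ge0. Qed.

Lemma enorm_ge0 x : 0 <= enorm x.
Proof. exact: sqrtr_ge0. Qed.

Lemma enorm_leP x k : 0 <= k -> (enorm x <= k) = (dot x x <= k ^+ 2).
Proof. by move=> k0; rewrite -enorm_sqr ler_sqr ?nnegrE ?enorm_ge0. Qed.

Lemma dot_le_enorm x y : dot x y <= enorm x * enorm y.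
Proof.
apply: le_trans (ler_norm _) _.
rewrite -ler_sqr ?nnegrE ?normr_ge0 ?mulr_ge0 ?enorm_ge0//.
by rewrite real_normK ?num_real// exprMn !enorm_sqr dot_cauchy_schwarz.
Qed.

Lemma enormN x : enorm (- x) = enorm x.
Proof. by rewrite /enorm dotNl dotNr opprK. Qed.

Lemma enorm_eq0 x : enorm x = 0 -> x = 0.
Proof. by move=> h; apply: dot_eq0; rewrite -enorm_sqr h expr2 mulr0. Qed.

Lemma enorm_gt0 x : x != 0 -> 0 < enorm x.
Proof.
by move=> x0; rewrite lt_def enorm_ge0 andbT; apply: contra_neq x0 => /enorm_eq0.
Qed.

Lemma enormZ k x : enorm (k *: x) = `|k| * enorm x.
Proof.
by rewrite /enorm dotZl dotZr mulrA -expr2 sqrtrM ?sqr_ge0// sqrtr_sqr.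
Qed.

Lemma enormD x y : enorm (x + y) <= enorm x + enorm y.
Proof.
rewrite enorm_leP ?addr_ge0 ?enorm_ge0// sqrrD !enorm_sqr !dotE (dotC y x).
have := dot_le_enorm x y; lra.
Qed.

Lemma sphere_dot x : sphere R n x -> dot x x = 1.
Proof. by rewrite /sphere/= => h; rewrite -enorm_sqr h expr1n. Qed.

(** The unit ball is strictly convex. *)
Lemma sphere_dot_lt1 x y : sphere R n x -> sphere R n y -> x != y ->
  dot x y < 1.
Proof.
move=> /sphere_dot hx /sphere_dot hy xy.
have : x - y != 0 by rewrite subr_eq0.
move=> /dot_gt0; rewrite !dotE hx hy (dotC y x); lra.
Qed.

Lemma dot_lt1 x y : enorm x < 1 -> sphere R n y -> dot x y < 1.
Proof.
move=> hx hy; apply: le_lt_trans (dot_le_enorm _ _) _.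
by rewrite [enorm y]hy mulr1.
Qed.

(** The topology is that of the supremum norm: this comparison transfers its
    compactness criterion to sets that are bounded in the Euclidean norm. *)
Lemma mx_norm_le_enorm x : `|x| <= enorm x.
Proof.
rewrite [leLHS]/Num.Def.normr/= mx_normrE.
apply/bigmax_leP; split => [|[i j] _]; first exact: enorm_ge0.
rewrite /= ord1 -[leLHS]ger0_norm// -ler_sqr ?nnegrE ?enorm_ge0//.
rewrite enorm_sqr normr_id real_normK ?num_real// /dot (bigD1 j)//= -expr2 lerDl.
by apply: sumr_ge0 => k _; rewrite -expr2 sqr_ge0.
Qed.

End InnerProduct.

Section FunctionwiseContinuity.
Context {R : realType} {T : topologicalType}.

Lemma continuous_addf (V : normedModType R) (f g : T -> V) (x : T) :
  {for x, continuous f} -> {for x, continuous g} ->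
  {for x, continuous (fun y => f y + g y)}.
Proof. by move=> cf cg; exact: cvgD. Qed.

Lemma continuous_subf (V : normedModType R) (f g : T -> V) (x : T) :
  {for x, continuous f} -> {for x, continuous g} ->
  {for x, continuous (fun y => f y - g y)}.
Proof. by move=> cf cg; exact: cvgB. Qed.

Lemma continuous_mulf (f g : T -> R) (x : T) :
  {for x, continuous f} -> {for x, continuous g} ->
  {for x, continuous (fun y => f y * g y)}.
Proof. by move=> cf cg; exact: cvgM. Qed.

End FunctionwiseContinuity.

Section InnerProductContinuity.
Context {R : realType} {n : nat}.

Lemma coord_continuous_rV (i : 'I_n) : continuous (fun x : 'rV[R]_n => x 0 i).
Proof. by move=> x; apply: (@coord_continuous R 1 n 0 i). Qed.

Lemma continuous_sum (T : topologicalType) (F : 'I_n -> T -> R) (x : T) :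
  (forall i, {for x, continuous (F i)}) ->
  {for x, continuous (fun y => \sum_i F i y)}.
Proof.
move=> h; apply: (cvg_big (@add_continuous R)) => i _.
exact: h.
Qed.

Lemma continuous_dot (T : topologicalType) (f g : T -> 'rV[R]_n) (x : T) :
  {for x, continuous f} -> {for x, continuous g} ->
  {for x, continuous (fun y => dot (f y) (g y))}.
Proof.
move=> cf cg; apply: continuous_sum => i; apply: cvgM.
  apply: (@continuous_comp _ _ _ f (fun v : 'rV[R]_n => v 0 i)) => //.
  exact: coord_continuous_rV.
apply: (@continuous_comp _ _ _ g (fun v : 'rV[R]_n => v 0 i)) => //.
exact: coord_continuous_rV.
Qed.

Lemma continuous_enorm (T : topologicalType) (f : T -> 'rV[R]_n) (x : T) :
  {for x, continuous f} -> {for x, continuous (fun y => enorm (f y))}.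
Proof.
move=> cf; apply: (@continuous_comp _ _ _ (fun y => dot (f y) (f y)) Num.sqrt).
  exact: continuous_dot.
exact: sqrt_continuous.
Qed.

Lemma compact_enorm (A : set 'rV[R]_n) (M : R) : closed A ->
  (forall x, A x -> enorm x <= M) -> compact A.
Proof.
move=> cA bA; apply: bounded_closed_compact => //.
exists M; split => [|k Mk x Ax]; first exact: num_real.
exact: le_trans (mx_norm_le_enorm x) (le_trans (bA _ Ax) (ltW Mk)).
Qed.

Lemma sphere_compact : compact (sphere R n).
Proof.
apply: (@compact_enorm _ 1); last by move=> x ->.
rewrite (_ : sphere R n = (@enorm R n) @^-1` [set 1]); last by [].
apply: preimage_closed; last exact: closed_eq.
by move=> x _; apply: (continuous_enorm (f := id)).
Qed.

End InnerProductContinuity.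

(** * Calculus of smooth functions *)

Section FunctionwiseDerivatives.
Context {R : realType} {V : normedModType R}.
Implicit Types (f g : V -> R) (x v : V).

Lemma is_derive_addf f g x v df dg : is_derive x v f df -> is_derive x v g dg ->
  is_derive x v (fun y => f y + g y) (df + dg).
Proof. exact: is_deriveD. Qed.

Lemma is_derive_subf f g x v df dg : is_derive x v f df -> is_derive x v g dg ->
  is_derive x v (fun y => f y - g y) (df - dg).
Proof. exact: is_deriveB. Qed.

Lemma is_derive_oppf f x v df : is_derive x v f df ->
  is_derive x v (fun y => - f y) (- df).
Proof. exact: is_deriveN. Qed.

Lemma is_derive_mulf f g x v df dg : is_derive x v f df -> is_derive x v g dg ->
  is_derive x v (fun y => f y * g y) (f x * dg + g x * df).
Proof. exact: is_deriveM. Qed.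

Lemma is_derive_sumf n (F : 'I_n -> V -> R) (dF : 'I_n -> R) x v :
  (forall i, is_derive x v (F i) (dF i)) ->
  is_derive x v (fun y => \sum_i F i y) (\sum_i dF i).
Proof.
move=> h; rewrite (_ : (fun y => _) = \sum_i F i); first exact: is_derive_sum.
by apply/funext => y; rewrite fct_sumE.
Qed.

Lemma is_derive_invf f x v df : f x != 0 -> is_derive x v f df ->
  is_derive x v (fun y => (f y)^-1) (- (f x) ^- 2 * df).
Proof.
move=> fx0 h; have df' : derivable f x v by [].
split; first exact: derivableV.
by rewrite (deriveV fx0 df') derive_val.
Qed.

(** Directional derivatives are ordinary derivatives along lines. *)
Lemma is_derive_line (f : V -> R) x v (s : R) : derivable f (x + s *: v) v ->
  is_derive s 1 (fun r : R => f (x + r *: v)) ('D_v f (x + s *: v)).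
Proof.
have e : (fun h : R => h^-1 *: (((fun r : R => f (x + r *: v)) \o shift s) (h *: 1)
      - f (x + s *: v)))
   = (fun h : R => h^-1 *: ((f \o shift (x + s *: v)) (h *: v) - f (x + s *: v))).
  apply/funext => h /=; congr (_ *: (f _ - _)).
  by rewrite [_ *: 1]mulr1 scalerDl addrC -!addrA (addrC (s *: v)).
move=> d; split; first by rewrite /derivable e.
by rewrite /derive e.
Qed.

End FunctionwiseDerivatives.

Section SmoothFunctions.
Context {R : realType} {V : normedModType R}.

Lemma smooth_continuous (W : normedModType R) (f : V -> W) :
  smooth f -> continuous f.
Proof. by move=> h; have := h 0%N. Qed.

Lemma smooth_differentiable (W : normedModType R) (f : V -> W) x :
  smooth f -> differentiable f x.
Proof. by move=> h; have [+ _] := h 1%N; apply. Qed.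

Lemma smooth_derive (W : normedModType R) (f : V -> W) v :
  smooth f -> smooth ('D_v f).
Proof. by move=> h k; have [_ +] := h k.+1; apply. Qed.

Lemma smooth_derivable (W : normedModType R) (f : V -> W) x v :
  smooth f -> derivable f x v.
Proof. by move=> sf; apply/diff_derivable/smooth_differentiable. Qed.

Lemma smooth_is_derive (W : normedModType R) (f : V -> W) x v :
  smooth f -> is_derive x v f ('D_v f x).
Proof. by move=> sf; apply/derivableP/smooth_derivable. Qed.

Lemma smooth_is_derive_line (f : V -> R) x v (s : R) : smooth f ->
  is_derive s 1 (fun r : R => f (x + r *: v)) ('D_v f (x + s *: v)).
Proof. by move=> sf; apply/is_derive_line/smooth_derivable. Qed.

Lemma continuous_line (x v : V) : continuous (fun s : R => x + s *: v).
Proof.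
by move=> s; apply: cvgD; [exact: cvg_cst|apply: cvgZr_tmp; exact: cvg_id].
Qed.

Lemma MVT_derive (f df : R -> R) (a b : R) : a <= b ->
  (forall s : R, is_derive s 1 f (df s)) ->
  exists2 c, a <= c <= b & f b - f a = df c * (b - a).
Proof.
move=> ab h.
have [|c] := MVT_segment ab (fun s _ => h s); last by rewrite in_itv/=; exists c.
apply: continuous_subspaceT => s; apply: differentiable_continuous.
by apply/derivable1_diffP; apply: ex_derive.
Qed.

Lemma smoothN (W : normedModType R) (f : V -> W) :
  smooth f -> smooth (fun x => - f x).
Proof.
move=> + k; elim: k f => [|k ih] f sf /=.
  by move=> x; apply: cvgN; apply: smooth_continuous.
split=> [x|v]; first exact/differentiableN/smooth_differentiable.
rewrite (_ : 'D_v (fun x => - f x) = (fun x => - 'D_v f x)).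
  exact/ih/smooth_derive.
by apply/funext => x; exact: (deriveN (smooth_derivable sf)).
Qed.

Lemma continuous_parallelogram (g : V -> R) x p q (e : R) :
  continuous g -> 0 < e ->
  exists2 d : R, 0 < d & forall a b, 0 <= a < d -> 0 <= b < d ->
    `|g x - g (x + a *: p + b *: q)| < e.
Proof.
move=> cg e0.
pose h := fun ab : R * R => x + ab.1 *: p + ab.2 *: q.
have ch : {for (0, 0), continuous (g \o h)}.
  apply: continuous_comp; last exact: cg.
  apply: cvgD; last by apply: cvgZr_tmp; exact: cvg_snd.
  by apply: cvgD; [exact: cvg_cst | apply: cvgZr_tmp; exact: cvg_fst].
have h0 : h (0, 0) = x by rewrite /h/= !scale0r !addr0.
move/cvgrPdist_lt : ch => /(_ _ e0); rewrite /= h0.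
move=> /nbhs_ballP[d/= d0 hd]; exists d => // a b /andP[a0 ad] /andP[b0 bd].
by apply: (hd (a, b)); split; rewrite /ball/= sub0r normrN ger0_norm.
Qed.

Lemma eq_at_corner (A B : V -> R) x v w : continuous A -> continuous B ->
  (forall s : R, 0 < s -> exists a b a' b',
    [/\ 0 <= a <= s, 0 <= b <= s, 0 <= a' <= s, 0 <= b' <= s &
     B (x + a *: v + b *: w) = A (x + a' *: w + b' *: v)]) ->
  A x = B x.
Proof.
move=> cA cB h; apply/eqP; rewrite -subr_eq0 -normr_le0.
apply/ler_addgt0Pl => e e0; rewrite addr0.
have e20 : 0 < e / 2 by lra.
have [d1 d10 h1] := continuous_parallelogram x w v cA e20.
have [d2 d20 h2] := continuous_parallelogram x v w cB e20.
pose s := Num.min d1 d2 / 2.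
have s0 : 0 < s by rewrite divr_gt0// lt_min d10.
have sd1 : s < d1 by rewrite ltr_pdivrMr// gt_min; apply/orP; left; lra.
have sd2 : s < d2 by rewrite ltr_pdivrMr// gt_min; apply/orP; right; lra.
have [a [b [a' [b' [aH bH aH' bH' ABE]]]]] := h s s0.
have := h1 a' b'; have := h2 a b; rewrite ABE => k2 k1.
have {}k1 : `|A x - A (x + a' *: w + b' *: v)| < e / 2 by apply: k1; lra.
have {}k2 : `|B x - A (x + a' *: w + b' *: v)| < e / 2 by apply: k2; lra.
move: k1 k2; rewrite !ltr_norml ler_norml; lra.
Qed.

Lemma second_difference (f : V -> R) x p q (s : R) : smooth f -> 0 <= s ->
  exists a b : R, [/\ 0 <= a <= s, 0 <= b <= s &
    f (x + s *: p + s *: q) - f (x + s *: p) - f (x + s *: q) + f x =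
    'D_q ('D_p f) (x + a *: p + b *: q) * s * s].
Proof.
move=> sf s0.
have [|a ha] := @MVT_derive (fun r => f (x + s *: q + r *: p) - f (x + r *: p))
  (fun r => 'D_p f (x + s *: q + r *: p) - 'D_p f (x + r *: p)) 0 s s0.
  by move=> r; apply: is_derive_subf; apply: smooth_is_derive_line.
rewrite !scale0r !addr0 subr0 => e1.
have [|b hb] := @MVT_derive (fun r => 'D_p f (x + a *: p + r *: q))
  (fun r => 'D_q ('D_p f) (x + a *: p + r *: q)) 0 s s0.
  by move=> r; apply: smooth_is_derive_line; apply: smooth_derive.
rewrite !scale0r !addr0 subr0 => e2.
exists a, b; split=> //; rewrite -e2.
have sE : x + s *: q + s *: p = x + s *: p + s *: q by rewrite addrAC.
have aE : x + s *: q + a *: p = x + a *: p + s *: q by rewrite addrAC.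
move: e1; rewrite sE aE => <-.
move: (f _) (f _) (f _) (f _) => *; ring.
Qed.

(** Symmetry of second derivatives: by the mean value theorem, the second
    difference of [f] over a small parallelogram with sides [s *: v] and
    [s *: w] equals [s ^+ 2] times a value of either mixed derivative near
    [x]. *)
Lemma derive_comm (f : V -> R) x v w : smooth f ->
  'D_v ('D_w f) x = 'D_w ('D_v f) x.
Proof.
move=> sf; apply: (@eq_at_corner ('D_v ('D_w f)) ('D_w ('D_v f)) x v w).
- by apply: smooth_continuous; do 2 apply: smooth_derive.
- by apply: smooth_continuous; do 2 apply: smooth_derive.
move=> s s0.
have [a [b [aH bH e1]]] := second_difference x v w sf (ltW s0).
have [a' [b' [aH' bH' e2]]] := second_difference x w v sf (ltW s0).
exists a, b, a', b'; split; [exact: aH|exact: bH|exact: aH'|exact: bH'|].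
apply: (mulIf (lt0r_neq0 s0)); apply: (mulIf (lt0r_neq0 s0)).
apply: etrans (esym e1) _; apply: etrans _ e2.
have sE : x + s *: w + s *: v = x + s *: v + s *: w by rewrite addrAC.
rewrite sE; move: (f _) (f _) (f _) (f _) => *; ring.
Qed.

End SmoothFunctions.

Lemma second_derivative_test (R : realType) (f g : R -> R) (c : R) :
  (forall s : R, is_derive s 1 f (g s)) -> is_derive (0 : R) 1 g c ->
  (\forall s \near (0 : R), f s <= f 0) -> g 0 = 0 /\ c <= 0.
Proof.
move=> df dg /nbhs_ballP[e/= e0 hmax].
have le0 s : `|s| < e -> f s <= f 0.
  by move=> se; apply: hmax; rewrite /ball/= sub0r normrN.
have g0 : g 0 = 0.
  have h : is_derive (0 : R) 1 f 0.
    apply: (@derive1_at_max R f (- e) e 0); first lra.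
    - by move=> t _; apply: ex_derive.
    - by rewrite in_itv/=; lra.
    - move=> t; rewrite in_itv/= => te; apply: le0; rewrite ltr_norml; exact: te.
  have e1 : 'D_1 f 0 = g 0 by apply: (@derive_val _ _ _ _ _ _ _ (df 0)).
  by rewrite -e1; apply: (@derive_val _ _ _ _ _ _ _ h).
split=> //; rewrite leNgt; apply/negP => c0.
have : (fun h : R => h^-1 *: ((g \o shift 0) (h *: 1) - g 0)) @ 0^' --> c.
  have e1 : 'D_1 g 0 = c by apply: (@derive_val _ _ _ _ _ _ _ dg).
  by rewrite -e1; apply: (@ex_derive _ _ _ _ _ _ _ dg).
move=> /cvgrPdist_lt /(_ _ c0); rewrite near_withinE => /nbhs_ballP[d/= d0 hd].
have gpos s : 0 < s < d -> 0 < g s.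
  move=> /andP[s0 sd].
  have := hd s; rewrite /ball/= sub0r normrN gtr0_norm// => /(_ sd (lt0r_neq0 s0)).
  rewrite g0 subr0 addr0 /GRing.scale/= mulr1 => h.
  have : 0 < s^-1 * g s by move: h; rewrite ltr_norml; lra.
  by rewrite pmulr_rgt0// invr_gt0.
pose s := Num.min e d / 2.
have s0 : 0 < s by rewrite divr_gt0// lt_min e0.
have se : s < e by rewrite ltr_pdivrMr// gt_min; apply/orP; left; lra.
have sd : s < d by rewrite ltr_pdivrMr// gt_min; apply/orP; right; lra.
have cf : {within `[0, s], continuous f}.
  apply: continuous_subspaceT => r; apply: differentiable_continuous.
  by apply/derivable1_diffP; apply: ex_derive.
have [r] := MVT s0 (fun r _ => df r) cf.
rewrite in_itv/= subr0 => /andP[r0 rs] hr.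
have : 0 < f s - f 0 by rewrite hr mulr_gt0// gpos// r0 (lt_trans rs).
by have := le0 s; rewrite gtr0_norm// => /(_ se); lra.
Qed.

Section Gradient.
Context {R : realType} {n : nat}.

Lemma derive_gradient (f : 'rV[R]_n -> R) x v : differentiable f x ->
  'D_v f x = dot (gradient f x) v.
Proof.
move=> df; rewrite (deriveE v df) {1}[v]row_sum_delta linear_sum.
apply: eq_bigr => i _; rewrite linearZ/= mxE /partial (deriveE _ df).
by rewrite [LHS]mulrC.
Qed.

End Gradient.

(** * The Gauss equation of a graph *)

Lemma sumr_lincomb (R : realType) n (c d : R) (F G : 'I_n -> R) :
  c * (\sum_i F i) - d * (\sum_i G i) = \sum_i (c * F i - d * G i).
Proof. by rewrite !mulr_sumr sumrB. Qed.

Section GraphCurvature.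
Context {R : realType} {n : nat}.
Variable u : 'rV[R]_n -> R.
Hypothesis smooth_u : smooth u.
Hypothesis spacelike_u : forall x, enorm (gradient u x) < 1.
Implicit Types (x v : 'rV[R]_n) (i j k l m : 'I_n).

Definition hess_entry i j : 'rV[R]_n -> R := partial i (partial j u).
Definition hess x : 'M[R]_n := \matrix_(i, j) hess_entry i j x.
(** Minus the Minkowski square of the normal vector [(Du, 1)]. *)
Definition lapse2 x : R := 1 - dot (gradient u x) (gradient u x).
Definition cometric x : 'M[R]_n :=
  1%:M + (lapse2 x)^-1 *: ((gradient u x)^T *m gradient u x).

Definition hess_grad i x : R := \sum_m hess_entry i m x * partial m u x.

Lemma lapse2_gt0 x : 0 < lapse2 x.
Proof.
rewrite subr_gt0 -enorm_sqr expr_lt1 ?enorm_ge0//; exact: spacelike_u.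
Qed.

Let lapse2_neq0 x : lapse2 x != 0.
Proof. exact/lt0r_neq0/lapse2_gt0. Qed.

Lemma smooth_partial i : smooth (partial i u).
Proof. exact: smooth_derive. Qed.

Lemma smooth_hess_entry i j : smooth (hess_entry i j).
Proof. exact/smooth_derive/smooth_partial. Qed.

Lemma hess_entryC i j x : hess_entry i j x = hess_entry j i x.
Proof. exact: derive_comm. Qed.

Lemma hess_sym x : (hess x)^T = hess x.
Proof. by apply/matrixP => i j; rewrite !mxE hess_entryC. Qed.

Let dpartial i j x : is_derive x 'e_i (partial j u) (hess_entry i j x).
Proof. exact/smooth_is_derive/smooth_partial. Qed.

(* [ring] and [field] compare atoms up to conversion, which is intractable when
   the atoms are derivatives: these are turned into variables beforehand. *)
Ltac name_atoms := repeat match goal with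
  | |- context [lapse2 ?x] =>
      generalize (lapse2_neq0 x); generalize (lapse2 x); intros ? ?
  | |- context [hess_entry ?i ?j ?x] => generalize (hess_entry i j x); intro
  | |- context [hess_grad ?i ?x] => generalize (hess_grad i x); intro
  | |- context [partial ?i ?f ?x] => generalize (partial i f x); intro
  | |- context [cometric ?x ?i ?j] => generalize (cometric x i j); intro
  end.

Let partial_hessC i j k x :
  partial j (hess_entry i k) x = partial i (hess_entry j k) x.
Proof. exact/derive_comm/smooth_partial. Qed.

Let dhess i j k x :
  is_derive x 'e_i (hess_entry j k) (partial i (hess_entry j k) x).
Proof. exact/smooth_is_derive/smooth_hess_entry. Qed.

Lemma derive_graph_map x v : 'D_v (graph_map u) x = (v, 'D_v u x).
Proof.
have du : differentiable u x by exact: smooth_differentiable.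
have di : differentiable (@id 'rV[R]_n) x by [].
have dp : differentiable (fun y => (id y, u y)) x by exact: differentiable_pair.
rewrite (deriveE v dp) diff_pair// -(deriveE v du).
by congr (_, _); rewrite diff_val.
Qed.

Lemma dot_delta i j : dot ('e_i : 'rV[R]_n) 'e_j = (i == j)%:R.
Proof.
rewrite /dot (bigD1 i)//= !mxE eqxx/= big1 => [|k ki].
  by rewrite eqxx mul1r addr0.
by rewrite !mxE/= (negbTE ki) mul0r.
Qed.

Lemma induced_metricE x i j :
  induced_metric u x i j = (i == j)%:R - partial i u x * partial j u x.
Proof. by rewrite mxE !derive_graph_map /mink/= dot_delta. Qed.

Lemma induced_metric_mx x :
  induced_metric u x = 1%:M - (gradient u x)^T *m gradient u x.
Proof.
apply/matrixP => i j; rewrite induced_metricE !mxE; congr (_ - _).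
by rewrite big_ord1 !mxE.
Qed.

Lemma metric_cometric x : induced_metric u x *m cometric x = 1%:M.
Proof.
rewrite induced_metric_mx /cometric; set a := gradient u x.
have aa : a *m a^T = (1 - lapse2 x)%:M.
  apply/matrixP => i j; rewrite !ord1 !mxE eqxx mulr1n /lapse2 opprB addrC subrK.
  by apply: eq_bigr => k _; rewrite !mxE.
have aaaa : a^T *m a *m (a^T *m a) = (1 - lapse2 x) *: (a^T *m a).
  by rewrite -mulmxA (mulmxA a) aa mul_scalar_mx -scalemxAr.
rewrite mulmxDr mulmx1 mulmxBl mul1mx -scalemxAr aaaa.
apply/matrixP => i j; rewrite ![in LHS]mxE [in RHS]mxE.
by name_atoms; field.
Qed.

Lemma invmx_induced_metric x : invmx (induced_metric u x) = cometric x.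
Proof.
have gk := metric_cometric x.
have [gu _] := mulmx1_unit gk.
by rewrite -[RHS](mulKmx gu) gk mulmx1.
Qed.

Lemma cometric_sym x : (cometric x)^T = cometric x.
Proof. by rewrite /cometric linearD/= trmx1 linearZ/= trmx_mul trmxK. Qed.

Lemma partial_induced_metric l i j x :
  partial l (fun y => induced_metric u y i j) x =
  - (partial i u x * hess_entry l j x + partial j u x * hess_entry l i x).
Proof.
rewrite (_ : (fun y => _) =
    fun y => (i == j)%:R - partial i u y * partial j u y); last first.
  by apply/funext => y; rewrite induced_metricE.
have h := is_derive_subf (is_derive_cst ((i == j)%:R : R) x 'e_l)
  (is_derive_mulf (dpartial l i x) (dpartial l j x)).
by rewrite /partial (@derive_val _ _ _ _ _ _ _ h) sub0r.
Qed.

Lemma christoffel_graph k i j x : christoffel (induced_metric u) k i j x =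
  - (partial k u x * hess_entry i j x) / lapse2 x.
Proof.
rewrite /christoffel invmx_induced_metric.
transitivity (2^-1 * \sum_(l < n)
    - 2 * hess_entry i j x * (cometric x k l * partial l u x)).
  congr (_ * _); apply: eq_bigr => l _; rewrite !partial_induced_metric.
  by rewrite (hess_entryC j i) (hess_entryC l j) (hess_entryC l i); name_atoms; ring.
rewrite -mulr_sumr.
suff -> : \sum_(l < n) cometric x k l * partial l u x = partial k u x / lapse2 x.
  by name_atoms; field.
transitivity (\sum_(l < n) ((k == l)%:R * partial l u x
    + (lapse2 x)^-1 * partial k u x * (gradient u x 0 l * gradient u x 0 l))).
  by apply: eq_bigr => l _; rewrite !mxE big_ord1 !mxE; name_atoms; ring.
rewrite big_split/= -mulr_sumr (bigD1 k)//= eqxx mul1r big1 ?addr0; last first.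
  by move=> l lk; rewrite eq_sym (negbTE lk) mul0r.
rewrite -[\sum_(_ < n) _]/(dot _ _).
have -> : dot (gradient u x) (gradient u x) = 1 - lapse2 x.
  by rewrite /lapse2; name_atoms; ring.
by name_atoms; field.
Qed.

Lemma is_derive_lapse2 i x : is_derive x 'e_i lapse2 (- 2 * hess_grad i x).
Proof.
rewrite (_ : lapse2 = fun y => 1 - \sum_m partial m u y * partial m u y); last first.
  apply/funext => y; rewrite /lapse2 /dot; congr (1 - _).
  by apply: eq_bigr => m _; rewrite !mxE.
have h := is_derive_subf (is_derive_cst (1 : R) x 'e_i)
  (is_derive_sumf (fun m => is_derive_mulf (dpartial i m x) (dpartial i m x))).
apply: (is_derive_eq h); rewrite sub0r /hess_grad mulr_sumr -sumrN.
by apply: eq_bigr => m _; name_atoms; ring.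
Qed.

Lemma partial_christoffel l i j k x :
  partial i (christoffel (induced_metric u) l j k) x =
  - (partial l u x * partial i (hess_entry j k) x
     + hess_entry j k x * hess_entry i l x) / lapse2 x
  - 2 * (partial l u x * hess_entry j k x) * hess_grad i x / lapse2 x ^+ 2.
Proof.
rewrite (_ : christoffel _ l j k =
    fun y => - (partial l u y * hess_entry j k y) * (lapse2 y)^-1); last first.
  by apply/funext => y; rewrite christoffel_graph.
have h := is_derive_mulf (is_derive_oppf (is_derive_mulf (dpartial i l x) (dhess i j k x)))
  (is_derive_invf (lapse2_neq0 x) (is_derive_lapse2 i x)).
rewrite [LHS](@derive_val _ _ _ _ _ _ _ h).
by name_atoms; field.
Qed.

(** In an affine chart the Levi-Civita connection of a graph is the rank one
    tensor [- Du * D^2u / lapse2]; the third derivatives cancel by symmetry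
    and what is left is quadratic in [D^2u], as predicted by the Gauss
    equation. *)
Lemma riemann_graph l k i j x : riemann (induced_metric u) l k i j x =
  - (hess_entry i l x * hess_entry j k x - hess_entry j l x * hess_entry i k x)
    / lapse2 x
  - partial l u x * (hess_grad i x * hess_entry j k x
                     - hess_grad j x * hess_entry i k x) / lapse2 x ^+ 2.
Proof.
rewrite /riemann !partial_christoffel.
rewrite partial_hessC.
have -> : \sum_(m < n)
    (christoffel (induced_metric u) l i m x * christoffel (induced_metric u) m j k x
     - christoffel (induced_metric u) l j m x * christoffel (induced_metric u) m i k x)
  = partial l u x * hess_entry j k x / lapse2 x ^+ 2 * hess_grad i x
    - partial l u x * hess_entry i k x / lapse2 x ^+ 2 * hess_grad j x.
  rewrite [RHS]sumr_lincomb; apply: eq_bigr => m _.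
  rewrite !christoffel_graph.
  by name_atoms; field.
by name_atoms; field.
Qed.

Lemma hess_gradE i x : hess_grad i x = (gradient u x *m hess x) 0 i.
Proof.
rewrite mxE; apply: eq_bigr => m _; rewrite !mxE hess_entryC.
name_atoms; ring.
Qed.

Lemma tr_shape x : \tr (cometric x *m hess x) =
  \sum_i hess_entry i i x + (lapse2 x)^-1 * \sum_i partial i u x * hess_grad i x.
Proof.
rewrite /cometric mulmxDl mul1mx linearD/=; congr (_ + _).
  by apply: eq_bigr => i _; rewrite mxE.
rewrite -scalemxAl linearZ/=; congr (_ * _).
rewrite -mulmxA mxtrace_mulC /mxtrace big_ord1 mxE.
by apply: eq_bigr => i _; rewrite -hess_gradE !mxE mulrC.
Qed.

Lemma ricci_graph x : (\matrix_(j, k) ricci (induced_metric u) j k x) =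
  - (lapse2 x)^-1 *: (\tr (cometric x *m hess x) *: hess x
                      - hess x *m cometric x *m hess x).
Proof.
have hessE i j : hess x i j = hess_entry i j x by rewrite mxE.
have hKhE j k : (hess x *m cometric x *m hess x) j k =
    \sum_i hess_entry j i x * hess_entry i k x
    + (lapse2 x)^-1 * (hess_grad j x * hess_grad k x).
  rewrite /cometric mulmxDr mulmx1 mulmxDl mxE; congr (_ + _).
    by rewrite mxE; apply: eq_bigr => i _; rewrite !hessE.
  rewrite -scalemxAr -scalemxAl [LHS]mxE; congr (_ * _).
  rewrite mulmxA -{1}hess_sym -trmx_mul -mulmxA [LHS]mxE big_ord1.
  by rewrite [_^T _ _]mxE -!hess_gradE.
have entry (a b : R) (A B : 'M[R]_n) j k :
    (a *: (b *: A - B)) j k = a * (b * A j k - B j k) by rewrite !mxE.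
apply/matrixP => j k; rewrite entry hessE hKhE tr_shape [LHS]mxE /ricci.
have -> : \sum_i riemann (induced_metric u) i k i j x =
    - (lapse2 x)^-1 * ((\sum_i hess_entry i i x) * hess_entry j k x
      - \sum_i hess_entry j i x * hess_entry i k x)
    - (lapse2 x)^-1 * (lapse2 x)^-1 *
      ((\sum_i partial i u x * hess_grad i x) * hess_entry j k x
      - hess_grad j x * hess_grad k x).
  rewrite [in X in X - _]mulr_suml -[in X in X - _]sumrB.
  rewrite [in X in _ - X]mulr_suml [in X in _ - X]mulr_sumr -[in X in _ - X]sumrB.
  rewrite [RHS]sumr_lincomb.
  apply: eq_bigr => i _; rewrite riemann_graph (hess_entryC k i).
  by name_atoms; field.
move: (\sum_i _) (\sum_i _) (\sum_i _) => ? ? ?.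
name_atoms; ring.
Qed.

(** The Gauss equation, contracted: with [A] the shape operator, whose matrix
    is [cometric *m hess] divided by the square root of [lapse2], the scalar
    curvature is [\tr (A ^ 2) - (\tr A) ^ 2]. *)
Lemma scalar_curvature_graph x : scalar_curvature (induced_metric u) x =
  - (\tr (cometric x *m hess x) ^+ 2
     - \tr (cometric x *m hess x *m (cometric x *m hess x))) / lapse2 x.
Proof.
rewrite /scalar_curvature invmx_induced_metric.
have -> : \sum_j \sum_k cometric x j k * ricci (induced_metric u) j k x =
    \tr (cometric x *m (\matrix_(j, k) ricci (induced_metric u) j k x)^T).
  apply: eq_bigr => j _; rewrite mxE; apply: eq_bigr => k _.
  by rewrite !mxE.
set K := cometric x; set h := hess x.
have -> : (\matrix_(j, k) ricci (induced_metric u) j k x)^T =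
    - (lapse2 x)^-1 *: (\tr (K *m h) *: h - h *m K *m h).
  by rewrite ricci_graph linearZ/= linearB/= linearZ/= !trmx_mul
     hess_sym cometric_sym mulmxA.
rewrite -scalemxAr mxtraceZ mulmxBr linearB/= -scalemxAr mxtraceZ !mulmxA.
move: (\tr _) (\tr _) => ? ?; name_atoms; ring.
Qed.

End GraphCurvature.

(** * Curvature in adapted frames *)

Section Frames.
Context {R : realType}.

Lemma common_zero (p q : 'rV[R]_3) :
  exists2 v : 'rV[R]_3, v != 0 & dot p v = 0 /\ dot q v = 0.
Proof.
have : kermx (col_mx p q)^T != 0.
  rewrite -mxrank_eq0 mxrank_ker subn_eq0 -ltnNge.
  by apply: leq_ltn_trans (rank_leq_col _) _.
move=> /rowV0Pn[v /sub_kermxP + v0]; rewrite tr_col_mx mul_mx_row.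
rewrite -(@row_mx0 R 1 1 1) => /eq_row_mx[pv qv].
have dotM (r : 'rV[R]_3) : dot r v = (v *m r^T) 0 0.
  by rewrite mxE; apply: eq_bigr => i _; rewrite mxE mulrC.
by exists v => //; rewrite !dotM pv qv mxE.
Qed.

(** The first fundamental form of a graph of slope [a]. *)
Definition slope_metric (a v w : 'rV[R]_3) : R := dot v w - dot a v * dot a w.

Lemma slope_metric_gt0 a v : enorm a < 1 -> v != 0 -> 0 < slope_metric a v v.
Proof.
move=> a1 v0; rewrite /slope_metric -expr2 subr_gt0.
apply: le_lt_trans (dot_cauchy_schwarz _ _) _.
rewrite -[ltRHS]mul1r ltr_pM2r ?dot_gt0// -enorm_sqr expr_lt1 ?enorm_ge0//.
Qed.

Lemma slope_metricC a v w : slope_metric a v w = slope_metric a w v.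
Proof. by rewrite /slope_metric dotC; ring. Qed.

Lemma unit_slope_metric a v : enorm a < 1 -> v != 0 ->
  exists2 k : R, k != 0 & slope_metric a (k *: v) (k *: v) = 1.
Proof.
move=> a1 v0; have g0 := slope_metric_gt0 a1 v0.
exists (Num.sqrt (slope_metric a v v))^-1; first by rewrite invr_eq0 sqrtr_eq0 -ltNge.
have -> k : slope_metric a (k *: v) (k *: v) = k * k * slope_metric a v v.
  by rewrite /slope_metric !dotE; ring.
have s2 : Num.sqrt (slope_metric a v v) ^+ 2 = slope_metric a v v.
  by rewrite sqr_sqrtr// ltW.
have s0 : Num.sqrt (slope_metric a v v) != 0 by rewrite sqrtr_eq0 -ltNge.
by rewrite -{3}s2; field.
Qed.

Lemma unit_common_zero a (p q : 'rV[R]_3) : enorm a < 1 ->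
  exists v, [/\ slope_metric a v v = 1, dot p v = 0 & dot q v = 0].
Proof.
move=> a1; have [v v0 [pv qv]] := common_zero p q.
have [k k0 kv] := unit_slope_metric a1 v0.
by exists (k *: v); rewrite !dotZr pv qv mulr0.
Qed.

(** Gram-Schmidt, backwards: the last two vectors are taken in the plane
    [theta = 0], and each vector is found as a common zero of the linear forms
    that express orthogonality to the previous ones. *)
Lemma adapted_frame (a theta : 'rV[R]_3) : enorm a < 1 ->
  exists e0 e1 e2 : 'rV[R]_3, [/\ dot theta e1 = 0, dot theta e2 = 0,
    [/\ slope_metric a e0 e0 = 1, slope_metric a e1 e1 = 1
      & slope_metric a e2 e2 = 1]
   & [/\ slope_metric a e0 e1 = 0, slope_metric a e0 e2 = 0
      & slope_metric a e1 e2 = 0]].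
Proof.
move=> a1.
have form v w : slope_metric a v w = dot (v - dot a v *: a) w.
  by rewrite /slope_metric !dotE mulrC; ring.
have [e2 [n2 t2 _]] := unit_common_zero theta theta a1.
have [e1 [n1 t1 q12]] := unit_common_zero theta (e2 - dot a e2 *: a) a1.
have [e0 [n0 q01 q02]] :=
  unit_common_zero (e1 - dot a e1 *: a) (e2 - dot a e2 *: a) a1.
exists e0, e1, e2; split=> //; split; rewrite slope_metricC form//.
Qed.

(** For a symmetric matrix of positive trace [H] and positive second symmetric
    function, [H ^+ 2] exceeds the square of each diagonal entry. So the sum of
    two diagonal entries is positive, and the second symmetric function is at
    most its value on the diagonal, where it is monotone. *)
Lemma sigma2_le (m00 m11 m22 m01 m02 m12 A B c : R) :
  0 < m00 + m11 + m22 -> 0 < c ->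
  c <= (m00 + m11 + m22) ^+ 2 - (m00 ^+ 2 + m11 ^+ 2 + m22 ^+ 2
         + 2 * (m01 ^+ 2 + m02 ^+ 2 + m12 ^+ 2)) ->
  0 <= A -> m00 <= A -> m11 <= B -> m22 <= B ->
  c <= 4 * (A * B) + 2 * B ^+ 2.
Proof.
move=> H0 c0 hc A0 hA hB1 hB2.
have S0 : 0 < m11 + m22.
  rewrite ltNge; apply/negP => S0.
  have : (m00 + m11 + m22) ^+ 2 <= m00 ^+ 2 by nra.
  have := sqr_ge0 m11; have := sqr_ge0 m22; have := sqr_ge0 m01.
  have := sqr_ge0 m02; have := sqr_ge0 m12; lra.
have k1 : m00 * (m11 + m22) <= A * (2 * B).
  apply: le_trans (_ : A * (m11 + m22) <= _); first by rewrite ler_pM2r.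
  by apply: ler_wpM2l => //; lra.
have k2 : (m11 + m22) ^+ 2 <= (2 * B) ^+ 2.
  by rewrite ler_sqr ?nnegrE; lra.
have := sqr_ge0 (m11 - m22); have := sqr_ge0 m01.
have := sqr_ge0 m02; have := sqr_ge0 m12; lra.
Qed.

End Frames.

Lemma mulmx_tr_entry (R : pzRingType) m n p (A : 'M[R]_(m, n)) (B : 'M[R]_(p, n)) i j :
  (A *m B^T) i j = (row i A *m (row j B)^T) 0 0.
Proof. by rewrite !mxE; apply: eq_bigr => k _; rewrite !mxE. Qed.

Section Touching.
Context {R : realType}.
Variable u : 'rV[R]_3 -> R.
Hypothesis smooth_u : smooth u.
Hypothesis spacelike_u : forall x, enorm (gradient u x) < 1.
Implicit Types (x v w z : 'rV[R]_3).

(** The shape operator of the graph has matrix [cometric *m hess] divided by the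
    square root of [lapse2]: the second symmetric function of the principal
    curvatures is at least [c / 2], on the branch of positive mean curvature. *)
Definition curvature_bound (c : R) : Prop := forall x,
  0 < \tr (cometric u x *m hess u x) /\
  c * lapse2 u x <= \tr (cometric u x *m hess u x) ^+ 2
     - \tr (cometric u x *m hess u x *m (cometric u x *m hess u x)).

Lemma derive2_hess v w x :
  'D_v ('D_w u) x = (v *m hess u x *m w^T) 0 0.
Proof.
have gradE : 'D_w u = fun y => \sum_j partial j u y * w 0 j.
  apply/funext => y; rewrite derive_gradient; last exact: smooth_differentiable.
  by apply: eq_bigr => j _; rewrite mxE.
have dj j : is_derive x v (fun y => partial j u y * w 0 j)
    (partial j u x * 0 + w 0 j * 'D_v (partial j u) x).
  by apply: is_derive_mulf; exact/smooth_is_derive/smooth_partial.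
rewrite gradE [LHS](@derive_val _ _ _ _ _ _ _ (is_derive_sumf dj)) mxE.
apply: eq_bigr => j _; rewrite mulr0 add0r [w^T _ _]mxE mulrC; congr (_ * _).
rewrite derive_gradient; last exact/smooth_differentiable/smooth_partial.
by rewrite mxE; apply: eq_bigr => i _; rewrite !mxE mulrC.
Qed.

(** Orthonormality of an adapted frame, in the form that the traces call for:
    when [cometric] is [E^T *m E], the trace of [cometric *m h] is that of the
    matrix of [h] in the frame. *)
Lemma cometric_frame (theta : 'rV[R]_3) x : exists E : 'M[R]_3,
  [/\ cometric u x = E^T *m E,
      forall i, slope_metric (gradient u x) (row i E) (row i E) = 1
    & forall i, i != 0 -> dot theta (row i E) = 0].
Proof.
set a := gradient u x.
have [e0 [e1 [e2 [t1 t2 onb ogl]]]] := adapted_frame theta (spacelike_u x).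
have [[n0 n1 n2] [q01 q02 q12]] := (onb, ogl).
pose e (i : 'I_3) := tnth [tuple e0; e1; e2] i.
pose E : 'M[R]_3 := \matrix_i e i.
have gE : E *m induced_metric u x *m E^T = 1%:M.
  apply/matrixP => i j; rewrite mulmx_tr_entry row_mul !rowK.
  rewrite induced_metric_mx// -/a.
  have -> : (e i *m (1%:M - a^T *m a) *m (e j)^T) 0 0 = slope_metric a (e i) (e j).
    have dotM (p q : 'rV[R]_3) : (p *m q^T) 0 0 = dot p q.
      by rewrite mxE; apply: eq_bigr => k _; rewrite mxE.
    have subE (p q : 'M[R]_1) : (p - q) 0 0 = p 0 0 - q 0 0 by rewrite !mxE.
    rewrite mulmxBr mulmx1 mulmxBl subE dotM mulmxA -mulmxA; congr (_ - _).
    by rewrite mxE big_ord1 !dotM dotC.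
  case: i j => [[|[|[|//]]] i3] [[|[|[|//]]] j3]; rewrite !mxE /e !(tnth_nth 0)/=;
    by rewrite // slope_metricC.
exists E; split=> [|i|i i0].
- have : E^T *m (E *m induced_metric u x) = 1%:M by apply: mulmx1C.
  rewrite mulmxA => h.
  by rewrite -[LHS]mul1mx -h -mulmxA metric_cometric// mulmx1.
- by rewrite rowK; case: i => [[|[|[|//]]] i3]; rewrite /e (tnth_nth 0)/=.
- rewrite rowK; move: i0; case: i => [[|[|[|//]]] i3]//;
    by rewrite /e (tnth_nth 0)/=.
Qed.

Lemma tr_cometric_sqr x (E : 'M[R]_3) : cometric u x = E^T *m E ->
  let M := E *m hess u x *m E^T in
  [/\ \tr (cometric u x *m hess u x) = \tr M,
      \tr (cometric u x *m hess u x *m (cometric u x *m hess u x)) = \tr (M *m M),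
      forall i j, M i j = M j i
    & forall i, M i i = 'D_(row i E) ('D_(row i E) u) x].
Proof.
move=> KE M; split=> [||i j|i].
- by rewrite KE -mulmxA mxtrace_mulC.
- by rewrite KE -!mulmxA mxtrace_mulC /M !mulmxA.
- have MT : M^T = M by rewrite /M !trmx_mul trmxK hess_sym// mulmxA.
  by rewrite -[in LHS]MT mxE.
- by rewrite derive2_hess /M mulmx_tr_entry row_mul.
Qed.

Lemma tr_shape_sqr_ge0 x :
  0 <= \tr (cometric u x *m hess u x *m (cometric u x *m hess u x)).
Proof.
have [E [KE _ _]] := cometric_frame 0 x.
have [_ -> Msym _] := tr_cometric_sqr KE.
apply: sumr_ge0 => i _; rewrite mxE; apply: sumr_ge0 => j _.
by rewrite (Msym j i) -expr2 sqr_ge0.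
Qed.

(** In a frame adapted to the plane [theta = 0] the hypotheses bound one
    diagonal entry of [D^2u] by [A] and the other two by [B]. *)
Lemma curvature_bound_hess (c : R) (theta : 'rV[R]_3) x (A B : R) :
  0 < c -> curvature_bound c -> 0 <= A ->
  (forall v, 'D_v ('D_v u) x <= A * slope_metric (gradient u x) v v) ->
  (forall v, dot theta v = 0 ->
     'D_v ('D_v u) x <= B * slope_metric (gradient u x) v v) ->
  c * lapse2 u x <= 4 * (A * B) + 2 * B ^+ 2.
Proof.
move=> c0 hc A0 hA hB.
have [E [KE nE tE]] := cometric_frame theta x.
have [trE trE2 Msym MiiE] := tr_cometric_sqr KE.
move: trE trE2 Msym MiiE; set M := E *m _ *m _; clearbody M.
move=> trE trE2 Msym MiiE.
have [] := hc x; rewrite trE trE2 => H0 hq.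
have sumE (F : 'I_3 -> R) : \sum_i F i = F 0 + F 1 + F (inord 2).
  by rewrite !big_ord_recl big_ord0 addr0 !addrA; congr (F _ + F _ + F _);
    apply/val_inj; rewrite /= ?inordK.
apply: (@sigma2_le _ (M 0 0) (M 1 1) (M (inord 2) (inord 2)) (M 0 1)
  (M 0 (inord 2)) (M 1 (inord 2)) A B) => //.
- by move: H0; rewrite /mxtrace sumE.
- by rewrite mulr_gt0// lapse2_gt0.
- apply: le_trans hq _; rewrite /mxtrace !sumE !mxE !sumE.
  rewrite (Msym 1 0) (Msym (inord 2) 0) (Msym (inord 2) 1).
  move: (M _ _) (M _ _) (M _ _) (M _ _) (M _ _) (M _ _) => *.
  by rewrite le_eqVlt; apply/orP; left; apply/eqP; ring.
- by rewrite MiiE; apply: le_trans (hA _) _; rewrite nE mulr1.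
- by rewrite MiiE; apply: le_trans (hB _ _) _; rewrite ?nE ?mulr1// tE.
- rewrite MiiE; apply: le_trans (hB _ _) _; rewrite ?nE ?mulr1// tE//.
  by rewrite -val_eqE/= inordK.
Qed.

End Touching.

(** * Comparison with quadrics *)

Section NullForms.
Context {R : realType} {n : nat}.
Variables y1 y2 : 'rV[R]_n.
Hypotheses (sy1 : sphere R n y1) (sy2 : sphere R n y2) (y12 : y1 != y2).

Definition null_gap : R := 1 - dot y1 y2.

Lemma null_gap_gt0 : 0 < null_gap.
Proof. by rewrite subr_gt0; exact: sphere_dot_lt1. Qed.

(** Up to the factor [2 / null_gap], the product of the two null coordinates of
    a vector is minus the Minkowski square of its projection to the timelike
    plane spanned by [(y1, 1)] and [(y2, 1)]; the remainder lies in the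
    orthogonal spacelike plane. *)
Lemma light_cone_le_null (w : 'rV[R]_n) (t : R) :
  t ^+ 2 - dot w w <= 2 / null_gap * ((t - dot w y1) * (t - dot w y2)).
Proof.
have d0 := null_gap_gt0; have d0' := lt0r_neq0 d0.
have := dot_cauchy_schwarz
  (w - null_gap^-1 *: ((t - dot w y2) *: y1 + (t - dot w y1) *: y2)) y1.
rewrite (sphere_dot sy1) mulr1 -subr_ge0 => h.
rewrite -subr_ge0; apply: le_trans h _; rewrite le_eqVlt; apply/orP; left.
rewrite !dotE (sphere_dot sy1) (sphere_dot sy2) !(dotC _ w) (dotC y2 y1).
move: d0'; have -> : dot y1 y2 = 1 - null_gap by rewrite /null_gap; ring.
move: null_gap => d d0'; apply/eqP; field; exact: d0'.
Qed.

End NullForms.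

Section Barrier.
Context {R : realType}.
Variable u : 'rV[R]_3 -> R.
Hypothesis smooth_u : smooth u.
Hypothesis spacelike_u : forall x, enorm (gradient u x) < 1.
Variables (y1 y2 x0 : 'rV[R]_3) (t0 : R).
Hypotheses (sy1 : sphere R 3 y1) (sy2 : sphere R 3 y2) (y12 : y1 != y2).
Implicit Types (x v w z y : 'rV[R]_3).

(** The null coordinate, with respect to the origin [(x0, t0)], of the point
    of the graph above [z]. *)
Definition null_coord y z : R := (u z - t0) - dot (z - x0) y.

Definition proper_time2 z : R := (u z - t0) ^+ 2 - dot (z - x0) (z - x0).

(** For [e = 1] the level sets are the hyperboloids centred at [(x0, t0)]. For
    small [e] they are hyperboloids that are stretched along the spacelike plane
    orthogonal to [(y1, 1)] and [(y2, 1)], hence almost flat in two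
    directions. *)
Definition barrier (e : R) z : R :=
  (1 - e) * (2 / null_gap y1 y2) * (null_coord y1 z * null_coord y2 z)
  + e * proper_time2 z.

Lemma proper_time2_le z : proper_time2 z <=
  2 / null_gap y1 y2 * (null_coord y1 z * null_coord y2 z).
Proof. exact: (light_cone_le_null sy1 sy2 y12). Qed.

Lemma barrier_cone e z : barrier e z = (1 - e) *
  (2 / null_gap y1 y2 * (null_coord y1 z * null_coord y2 z))
  + e * proper_time2 z.
Proof. by rewrite /barrier -(mulrA (1 - e)). Qed.

Lemma barrier_le (e : R) z : 0 <= e -> barrier e z <=
  2 / null_gap y1 y2 * (null_coord y1 z * null_coord y2 z).
Proof.
move=> e0; have := proper_time2_le z; rewrite barrier_cone.
move: (2 / _ * _) (proper_time2 z) => p q pq.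
by have := ler_wpM2l e0 pq; lra.
Qed.

Let continuous_height : continuous (fun z => u z - t0).
Proof.
by move=> z; apply: continuous_subf; [exact: smooth_continuous|exact: cst_continuous].
Qed.

Let continuous_center : continuous (fun z => z - x0).
Proof.
move=> z; apply: (continuous_subf (f := id) (g := cst x0)) => //.
exact: cst_continuous.
Qed.

Lemma continuous_null_coord y : continuous (null_coord y).
Proof.
move=> z; apply: (continuous_subf (f := fun z => u z - t0)
  (g := fun z => dot (z - x0) y)); first exact: continuous_height.
apply: (continuous_dot (f := fun z => z - x0) (g := cst y)).
  exact: continuous_center.
exact: cst_continuous.
Qed.

Lemma continuous_proper_time2 : continuous proper_time2.
Proof.
move=> z; apply: (continuous_subf (f := fun z => (u z - t0) ^+ 2)
  (g := fun z => dot (z - x0) (z - x0))).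
  by apply: continuous_mulf; exact: continuous_height.
by apply: (continuous_dot (f := fun z => z - x0) (g := fun z => z - x0));
  exact: continuous_center.
Qed.

Lemma continuous_barrier e : continuous (barrier e).
Proof.
move=> z; apply: (continuous_addf (g := fun z => e * proper_time2 z)
  (f := fun z => (1 - e) * (2 / null_gap y1 y2) *
           (null_coord y1 z * null_coord y2 z))).
  apply: continuous_mulf; first exact: cst_continuous.
  by apply: continuous_mulf; exact: continuous_null_coord.
by apply: continuous_mulf; [exact: cst_continuous|exact: continuous_proper_time2].
Qed.

Lemma barrier_derivatives (e : R) z v : (\forall x \near z, barrier e x <= barrier e z) ->
  let k := (1 - e) / null_gap y1 y2 in
  let L1 := null_coord y1 z in let L2 := null_coord y2 z in
  let T := e * (u z - t0) + k * (L1 + L2) in let U' := 'D_v u z in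
  T * U' = k * (dot v y1 * L2 + dot v y2 * L1) + e * dot (z - x0) v /\
  T * 'D_v ('D_v u) z <= e * (dot v v - U' ^+ 2)
    - 2 * k * ((U' - dot v y1) * (U' - dot v y2)).
Proof.
move=> zmax k L1 L2 T U'.
pose U (s : R) := u (z + s *: v) - t0.
pose L y (s : R) := U s - (dot (z - x0) y + s * dot v y).
pose f (s : R) := 2 * k * (L y1 s * L y2 s) + e * (U s * U s
   - (dot (z - x0) (z - x0) + s * (2 * dot (z - x0) v) + s * s * dot v v)).
have LE y s : null_coord y (z + s *: v) = L y s.
  by by rewrite /null_coord /L /U !dotE; ring.
have fE s : f s = barrier e (z + s *: v).
  rewrite /barrier /proper_time2 !LE -/(U s) /f /k !dotE (dotC v z) (dotC v x0)
    (dotC x0 z).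
  ring.
have dlin (c s : R) : is_derive s 1 (fun r : R => r * c) c.
  have h := is_derive_mulf (is_derive_id s 1) (is_derive_cst c s 1).
  by apply: (is_derive_eq h); rewrite mulr0 add0r mulr1.
have dU (s : R) : is_derive s 1 U ('D_v u (z + s *: v)).
  have h := is_derive_subf (smooth_is_derive_line z v s smooth_u)
    (is_derive_cst (t0 : R) s 1).
  by apply: (is_derive_eq h); rewrite subr0.
pose V (s : R) := 'D_v u (z + s *: v).
have dV (s : R) : is_derive s 1 V ('D_v ('D_v u) (z + s *: v)).
  by apply: smooth_is_derive_line; exact: smooth_derive.
have dL y (s : R) : is_derive s 1 (L y) (V s - dot v y).
  have h := is_derive_subf (dU s)
    (is_derive_addf (is_derive_cst (dot (z - x0) y) s 1) (dlin (dot v y) s)).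
  by apply: (is_derive_eq h); rewrite add0r.
pose g (s : R) := 2 * k * (L y1 s * (V s - dot v y2) + L y2 s * (V s - dot v y1))
  + e * (2 * (U s * V s) - (2 * dot (z - x0) v + s * (2 * dot v v))).
have dquad (s : R) : is_derive s 1 (fun r : R => r * r * dot v v) (s * (2 * dot v v)).
  have h := is_derive_mulf (is_derive_mulf (is_derive_id s 1) (is_derive_id s 1))
    (is_derive_cst (dot v v) s 1).
  by apply: (is_derive_eq h); move: (dot v v) => c; rewrite /cst; ring.
have df (s : R) : is_derive s 1 f (g s).
  have h := is_derive_addf
    (is_derive_mulf (is_derive_cst (2 * k) s 1)
      (is_derive_mulf (dL y1 s) (dL y2 s)))
    (is_derive_mulf (is_derive_cst e s 1) (is_derive_subf
      (is_derive_mulf (dU s) (dU s))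
      (is_derive_addf (is_derive_addf
         (is_derive_cst (dot (z - x0) (z - x0)) s 1) (dlin (2 * dot (z - x0) v) s))
         (dquad s)))).
  apply: (is_derive_eq h); rewrite /g -/(V s) /cst.
  move: (V s) (U s) (L _ s) (L _ s) (dot _ _) (dot _ _) (dot _ _) (dot _ _) (dot _ _).
  by move=> *; ring.
pose c := 2 * k * (2 * (U' - dot v y1) * (U' - dot v y2)
    + (L1 + L2) * 'D_v ('D_v u) z)
  + e * (2 * (U' ^+ 2 + (u z - t0) * 'D_v ('D_v u) z) - 2 * dot v v).
have z0 : z + 0 *: v = z by rewrite scale0r addr0.
have L0 y : L y 0 = null_coord y z by rewrite -LE z0.
have U0 : U 0 = u z - t0 by rewrite /U z0.
have V0 : V 0 = U' by rewrite /V z0.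
have dg : is_derive (0 : R) 1 g c.
  have dW y (s : R) : is_derive s 1 (fun r : R => V r - dot v y)
      ('D_v ('D_v u) (z + s *: v)).
    have h := is_derive_subf (dV s) (is_derive_cst (dot v y) s 1).
    by apply: (is_derive_eq h); rewrite subr0.
  have h := is_derive_addf
    (is_derive_mulf (is_derive_cst (2 * k) (0 : R) 1) (is_derive_addf
      (is_derive_mulf (dL y1 0) (dW y2 0)) (is_derive_mulf (dL y2 0) (dW y1 0))))
    (is_derive_mulf (is_derive_cst e (0 : R) 1) (is_derive_subf
      (is_derive_mulf (is_derive_cst (2 : R) (0 : R) 1)
        (is_derive_mulf (dU 0) (dV 0)))
      (is_derive_addf (is_derive_cst (2 * dot (z - x0) v) (0 : R) 1)
         (dlin (2 * dot v v) 0)))).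
  apply: (is_derive_eq h); rewrite -/(V 0) /cst !L0 U0 !V0 z0 /c -/L1 -/L2.
  move: ('D_v ('D_v u) z) (U') (u z) (L1) (L2) (dot _ _) (dot _ _) (dot _ _).
  by move=> *; ring.
have fmax : \forall s \near (0 : R), f s <= f 0.
  have h := @continuous_line R 'rV[R]_3 z v (0 : R)
    [set x | barrier e x <= barrier e z].
  rewrite z0 in h.
  have {}h : \forall s \near (0 : R), barrier e (z + s *: v) <= barrier e z.
    exact: h zmax.
  by apply: filterS h => s; rewrite !fE z0.
have [g0 c0] := second_derivative_test df dg fmax.
move: g0 c0; rewrite /g /c !L0 U0 V0 -/L1 -/L2 /T.
move: ('D_v ('D_v u) z) (U') (u z) (L1) (L2) (k) (dot _ _) (dot _ _) (dot _ _) (dot _ _).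
move=> D' U'' uz l1 l2 k' p1 p2 p3 p4 g0 c0; split; first by lra.
by lra.
Qed.

(** At an interior maximum of the barrier the graph touches a level set from
    below. On the tangent vectors that are annihilated by the linear part of the
    null coordinate of [y1], the quadratic form of the barrier is [e] times that
    of the proper time. So the two curvatures of the level set in these
    directions are smaller by a factor [e] than the bound that holds in all
    directions. *)
Lemma barrier_max_le (c e : R) z : 0 < c -> curvature_bound u c ->
  0 < e <= 1 -> (\forall x \near z, barrier e x <= barrier e z) ->
  0 < barrier e z -> 0 < null_coord y1 z -> 0 < null_coord y2 z ->
  c * barrier e z <= 6 * e.
Proof.
move=> c0 hc /andP[e0 e1] zmax F0 L1p L2p.
have d0 := null_gap_gt0 sy1 sy2 y12.
have der v := barrier_derivatives v zmax.
move: der => /=; set k := (1 - e) / null_gap y1 y2; set T := e * _ + _ => der.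
set a := gradient u z; set w := z - x0; set t := u z - t0.
set L1 := null_coord y1 z in L1p *; set L2 := null_coord y2 z in L2p *.
have DE v : 'D_v u z = dot a v.
  by rewrite derive_gradient//; exact: smooth_differentiable.
have TaE : T *: a = k *: (L2 *: y1 + L1 *: y2) + e *: w.
  have E (p : 'rV[R]_3) v :
      dot (T *: a - (k *: (L2 *: y1 + L1 *: y2) + e *: p)) v =
      T * dot a v - (k * (dot v y1 * L2 + dot v y2 * L1) + e * dot p v).
    by rewrite !dotE (dotC v y1) (dotC v y2); ring.
  apply/eqP; rewrite -subr_eq0; apply/eqP; apply: dot_eq0; rewrite E.
  by rewrite -DE (der _).1 subrr.
have L1E : L1 = t - dot w y1 by [].
have L2E : L2 = t - dot w y2 by [].
have FE : barrier e z = (1 - e) * (2 / null_gap y1 y2 * (L1 * L2))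
    + e * (t ^+ 2 - dot w w) by exact: barrier_cone.
have TE : T = e * t + k * (L1 + L2) by [].
have kE : k = (1 - e) / null_gap y1 y2 by [].
clearbody T k L1 L2 t w.
have Q := light_cone_le_null sy1 sy2 y12 w t.
rewrite -L1E -L2E in Q.
(* [T ^+ 2 * lapse2] is minus the Minkowski square of half the gradient of the
   quadratic form. In a frame adapted to the two null directions the form has
   coefficients [1, -1, - e, - e] and half its gradient squares to the form with
   coefficients [1, -1, - e ^+ 2, - e ^+ 2]. *)
have T2 : barrier e z <= T ^+ 2 * lapse2 u z.
  have -> : T ^+ 2 * lapse2 u z = T ^+ 2 - dot (T *: a) (T *: a).
    by rewrite /lapse2 -/a dotZl dotZr; ring.
  rewrite FE TaE !dotE (sphere_dot sy1) (sphere_dot sy2).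
  rewrite !(dotC _ w) (dotC y2 y1).
  have y12E : dot y1 y2 = 1 - null_gap y1 y2 by rewrite /null_gap; ring.
  have wy1 : dot w y1 = t - L1 by rewrite L1E; ring.
  have wy2 : dot w y2 = t - L2 by rewrite L2E; ring.
  rewrite y12E wy1 wy2 TE kE.
  have e2 : 0 <= e * (1 - e) by rewrite mulr_ge0 ?subr_ge0// ltW.
  have := mulr_ge0 e2 (_ : 0 <= 2 / null_gap y1 y2 * (L1 * L2)
                                 - (t ^+ 2 - dot w w)).
  rewrite subr_ge0 => /(_ Q) h; rewrite -subr_ge0.
  apply: le_trans h _; rewrite le_eqVlt; apply/orP; left; apply/eqP.
  by field; exact: lt0r_neq0.
have l0 := lapse2_gt0 spacelike_u z.
have Tpos : 0 < T.
  have ay1 := dot_lt1 (spacelike_u z) sy1; rewrite -/a in ay1.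
  have y12E : dot y1 y2 = 1 - null_gap y1 y2 by rewrite /null_gap; ring.
  have : T * (1 - dot a y1) = L1.
    have -> : T * (1 - dot a y1) = T - dot (T *: a) y1 by rewrite dotZl; ring.
    rewrite TaE !dotE (sphere_dot sy1) (dotC y2 y1) y12E.
    have -> : dot w y1 = t - L1 by rewrite L1E; ring.
    rewrite TE kE; field; exact: lt0r_neq0.
  move=> h; have : 0 < T * (1 - dot a y1) by rewrite h.
  by rewrite pmulr_lgt0// subr_gt0.
have gE v : dot v v - dot a v ^+ 2 = slope_metric a v v.
  by rewrite /slope_metric expr2.
have kd : 2 * k = (1 - e) * (2 / null_gap y1 y2) by rewrite kE; ring.
have dirA v : 'D_v ('D_v u) z <= T^-1 * slope_metric a v v.
  have [_] := der v; rewrite DE gE => h.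
  rewrite -(ler_pM2l Tpos) mulrA divff ?lt0r_neq0// mul1r; apply: le_trans h _.
  have := light_cone_le_null sy1 sy2 y12 v (dot a v).
  have -> : dot a v ^+ 2 - dot v v = - slope_metric a v v by rewrite -gE; ring.
  move=> h; have e1' : 0 <= 1 - e by rewrite subr_ge0.
  have := ler_wpM2l e1' h; rewrite kd mulrA; lra.
have dirB v : dot (a - y1) v = 0 -> 'D_v ('D_v u) z <= e / T * slope_metric a v v.
  rewrite dotDl dotNl (dotC y1) => hv; have [_] := der v; rewrite DE gE hv.
  rewrite mul0r mulr0 subr0 => h.
  have -> : e / T * slope_metric a v v = T^-1 * (e * slope_metric a v v) by ring.
  by rewrite -(ler_pM2l Tpos) mulrA divff ?lt0r_neq0// mul1r.
have A0 : 0 <= T^-1 by rewrite invr_ge0 ltW.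
have := curvature_bound_hess smooth_u spacelike_u c0 hc A0 dirA dirB.
move=> h; have T20 : 0 < T ^+ 2 by rewrite exprn_gt0.
have {}h : c * (T ^+ 2 * lapse2 u z) <= 4 * e + 2 * e ^+ 2.
  have -> : c * (T ^+ 2 * lapse2 u z) = T ^+ 2 * (c * lapse2 u z) by ring.
  have -> : 4 * e + 2 * e ^+ 2 =
      T ^+ 2 * (4 * (T^-1 * (e / T)) + 2 * (e / T) ^+ 2).
    by field; exact: lt0r_neq0.
  by rewrite ler_pM2l.
apply: le_trans (_ : c * (T ^+ 2 * lapse2 u z) <= _); first by rewrite ler_pM2l.
apply: le_trans h _; nra.
Qed.

End Barrier.

(** * Null hyperplanes and the domain of dependence *)

Section SmoothExamples.
Context {R : realType} {V W : normedModType R}.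

Lemma is_Ck_cst k (c : W) : is_Ck k (cst c : V -> W).
Proof.
elim: k c => [|k ih] c /=; first exact: cst_continuous.
split=> [x|v]; first exact: differentiable_cst.
rewrite (_ : 'D_v (cst c) = cst 0); first exact: ih.
by apply/funext => x; rewrite derive_cst.
Qed.

Lemma smooth_affine (f : V -> W) : (forall x, differentiable f x) ->
  (forall v, exists c, forall x, 'D_v f x = c) -> smooth f.
Proof.
move=> df cf [|k] /=; first by move=> x; exact: differentiable_continuous.
split=> // v; have [c hc] := cf v.
by rewrite (_ : 'D_v f = cst c); [exact: is_Ck_cst|apply/funext].
Qed.

Lemma is_diff_line (x v : V) (s : R) :
  is_diff s (fun r : R => x + r *: v) (fun r : R => r *: v).
Proof.
have d := is_diffD (is_diff_cst x s) (is_diff_scalel s v).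
apply: (@is_diff_eq _ _ _ _ _ _ _ d).
by apply/funext => r; rewrite [LHS]add0r.
Qed.

Lemma derive_line (x v : V) (s w : R) :
  'D_w (fun r : R => x + r *: v) s = w *: v.
Proof.
have d := is_diff_line x v s.
by rewrite (deriveE w (@ex_diff _ _ _ _ _ _ _ d)) (@diff_val _ _ _ _ _ _ _ d).
Qed.

End SmoothExamples.

Section Causality.
Context {R : realType} {n : nat}.
Implicit Types (x y z w : 'rV[R]_n).

(** The null hyperplane through [(x0, t0)] in the null direction [(y, 1)]
    lies below the graph of [u]. *)
Definition null_support (u : 'rV[R]_n -> R) x0 (t0 : R) y : Prop :=
  forall z, t0 + dot (z - x0) y <= u z.

(** Compactness of the sphere of null directions: a support hyperplane exists
    as soon as it exists up to an error that is arbitrarily small on bounded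
    sets. *)
Lemma null_support_limit (u : 'rV[R]_n -> R) x0 t0 :
  (forall r, 0 < r -> exists2 y, sphere R n y & forall z,
     t0 + dot (z - x0) y - (dot (z - x0) (z - x0) + 1) / r <= u z) ->
  exists2 y, sphere R n y & null_support u x0 t0 y.
Proof.
move=> h.
have /choice[Y hY] : forall k : nat, exists y, sphere R n y /\ forall z,
    t0 + dot (z - x0) y - (dot (z - x0) (z - x0) + 1) / k.+1%:R <= u z.
  by move=> k; have [|y sy hy] := h k.+1%:R; [|exists y].
have FY : (Y @ \oo) (sphere R n) by exists 0%N => // k _; have [] := hY k.
have [y [sy cy]] := @sphere_compact R n (Y @ \oo) _ FY.
exists y => // z; rewrite leNgt; apply/negP => uz.
pose q := dot (z - x0) (z - x0) + 1.
have q0 : 0 < q by rewrite /q; have := dot_ge0 (z - x0); lra.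
pose d := t0 + dot (z - x0) y - u z.
have d0 : 0 < d by rewrite subr_gt0.
pose A := [set p : 'rV[R]_n | t0 + dot (z - x0) p - d / 2 <= u z].
have YA : (Y @ \oo) A.
  exists (Num.truncn (2 * q / d)) => // k /= mk.
  have [_ /(_ z)] := hY k; rewrite -/q; apply: le_trans.
  rewrite lerD2l lerN2 ler_pdivrMr ?ltr0n// mulrC -ler_pdivrMr; last by lra.
  have := truncnS_gt (2 * q / d); rewrite -addn1 natrD => tk.
  have kk : (Num.truncn (2 * q / d))%:R <= k%:R :> R by rewrite ler_nat.
  rewrite (_ : q / (d / 2) = 2 * q / d); last by field; exact: lt0r_neq0.
  by rewrite -addn1 natrD; lra.
pose B := [set p : 'rV[R]_n | t0 + dot (z - x0) p - d / 2 > u z].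
have nB : nbhs y B.
  have cf : {for y, continuous (fun p : 'rV[R]_n => dot (z - x0) p)}.
    apply: (continuous_dot (f := cst (z - x0)) (g := id)); last by [].
    exact: cst_continuous.
  have d20 : 0 < d / 2 by lra.
  move/cvgrPdist_lt : cf => /(_ _ d20); apply: filterS => p /=.
  by rewrite ltr_norml /B/= /d => /andP[]; lra.
have [p [Ap Bp]] := cy _ _ YA nB.
by move: Ap Bp; rewrite /A /B/=; lra.
Qed.

(** If the graph of [u] meets the future light cone of [(x0, t0)] in an
    unbounded set, then a limit of the directions in which it does supports
    [u], since [u] is bounded below by backward cones. *)
Lemma null_support_of_unbounded (u : 'rV[R]_n -> R) x0 t0 :
  (forall x y, u x - u y <= enorm (x - y)) ->
  (forall r, exists2 z, r <= enorm (z - x0) & t0 + enorm (z - x0) <= u z) ->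
  exists2 y, sphere R n y & null_support u x0 t0 y.
Proof.
move=> lip h; apply: null_support_limit => r r0.
have [z0 rz0 uz0] := h r; set w0 := z0 - x0 in rz0 uz0.
have rho0 : 0 < enorm w0 by lra.
have w0E := enorm_sqr w0.
exists ((enorm w0)^-1 *: w0).
  by rewrite /sphere/= enormZ gtr0_norm ?invr_gt0// mulVf// lt0r_neq0.
move=> z; set w := z - x0.
have zz0 : z0 - z = w0 - w.
  by rewrite /w0 /w opprB addrA subrK.
have := lip z0 z; rewrite {}zz0 => hl; clearbody w0 w.
have s2 := enorm_sqr (w0 - w); rewrite !dotE (dotC w0 w) in s2.
have sq := sqr_ge0 (enorm (w0 - w) - enorm w0).
rewrite dotZr.
set rho := enorm w0 in rz0 uz0 rho0 w0E sq *.
have ri : rho^-1 <= r^-1 by rewrite lef_pV2.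
have ww := dot_ge0 w.
have k1 : enorm (w0 - w) <= rho - rho^-1 * dot w w0 + dot w w * rho^-1 / 2.
  rewrite -(ler_pM2l rho0).
  have -> : rho * (rho - rho^-1 * dot w w0 + dot w w * rho^-1 / 2)
     = rho ^+ 2 - dot w w0 + dot w w / 2 by field; exact: lt0r_neq0.
  move: sq; rewrite sqrrB s2 -w0E; lra.
have k2 : dot w w * rho^-1 <= dot w w * r^-1 by rewrite ler_wpM2l.
have ri0 : 0 < r^-1 by rewrite invr_gt0.
have k3 : 0 <= dot w w * r^-1 by rewrite mulr_ge0// ltW.
rewrite mulrDl mul1r; lra.
Qed.

Variable u : 'rV[R]_n -> R.
Hypothesis smooth_u : smooth u.
Hypothesis spacelike_u : forall x, enorm (gradient u x) < 1.

Lemma strict_lipschitz x y : x != y -> u x - u y < enorm (x - y).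
Proof.
move=> xy.
have [||c _] := @MVT_derive R (fun s => u (y + s *: (x - y)))
  (fun s => 'D_(x - y) u (y + s *: (x - y))) 0 1.
- exact: ler01.
- by move=> s; exact: smooth_is_derive_line.
rewrite scale1r scale0r addr0 (addrC y) subrK subr0 mulr1 => ->.
rewrite derive_gradient; last exact: smooth_differentiable.
apply: le_lt_trans (dot_le_enorm _ _) _.
by rewrite -[ltRHS]mul1r ltr_pM2r ?enorm_gt0 ?subr_eq0.
Qed.

Lemma lipschitz x y : u x - u y <= enorm (x - y).
Proof.
have [->|/strict_lipschitz/ltW//] := eqVneq x y.
by rewrite subrr enorm_ge0.
Qed.

Lemma null_support_strict x0 t0 y z : sphere R n y ->
  null_support u x0 t0 y -> t0 + dot (z - x0) y < u z.
Proof.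
move=> sy sup; rewrite lt_neqAle sup andbT; apply/eqP => e.
have yy : y != 0.
  by apply/eqP => y0; move: (sphere_dot sy); rewrite y0 dot0l; lra.
have zy : z + y - z = y by rewrite addrC addKr.
have zy0 : z + y != z by rewrite -subr_eq0 zy.
have := sup (z + y); have := strict_lipschitz zy0.
by move: e; rewrite zy [enorm y]sy !dotE (sphere_dot sy); lra.
Qed.

Lemma causal_lipschitz (f : R -> 'rV[R]_n) (s t : R) : causal_curve f -> s <= t ->
  enorm (f t - f s) <= t - s.
Proof.
move=> [sf cf] st; set w := f t - f s.
have dc (r : R) i : is_derive r 1 (fun q => f q 0 i) ('D_1 f r 0 i).
  have df : derivable f r 1 by exact: smooth_derivable.
  split; first by move/derivable_mxP : df.
  by rewrite (derive_mx df) mxE.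
have [||c _] := @MVT_derive R (fun r => dot (f r) w)
  (fun r => dot ('D_1 f r) w) s t.
- exact: st.
- move=> r; apply: is_derive_sumf => i.
  have h := is_derive_mulf (dc r i) (is_derive_cst (w 0 i) r 1).
  by apply: (is_derive_eq h); rewrite mulr0 add0r mulrC.
have -> : dot (f t) w - dot (f s) w = enorm w * enorm w.
  by rewrite -expr2 enorm_sqr {3}/w dotDl dotNl.
have [->|w0] := eqVneq w 0.
  by move=> _; rewrite /enorm dot0l sqrtr0 subr_ge0.
move=> h; rewrite -(ler_pM2l (enorm_gt0 w0)) h.
apply: ler_wpM2r; first by rewrite subr_ge0.
apply: le_trans (dot_le_enorm _ _) _.
by rewrite -[leRHS]mul1r ler_pM2r ?enorm_gt0.
Qed.

Lemma causal_line x y : sphere R n y -> causal_curve (fun s : R => x + s *: y).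
Proof.
move=> sy.
split; last by move=> t; rewrite derive_line scale1r sy.
apply: smooth_affine => [s|v].
  exact: (@ex_diff _ _ _ _ _ _ _ (is_diff_line x y s)).
by exists (v *: y) => s; exact: derive_line.
Qed.

Definition legendre (y : sphere R n) : \bar R :=
  ereal_sup [set (dot x (set_val y) - u x)%:E | x in [set: 'rV[R]_n]].

Lemma legendre_le (y : sphere R n) (b : R) :
  (legendre y <= b%:E)%E <-> forall z, dot z (set_val y) - b <= u z.
Proof.
split=> [h z|h].
  have : ((dot z (set_val y) - u z)%:E <= b%:E)%E.
    by apply: le_trans h; apply: ereal_sup_ubound; exists z.
  by rewrite lee_fin; lra.
by apply: ge_ereal_sup => _ [z _ <-]; rewrite lee_fin; have := h z; lra.
Qed.

Lemma legendre_gtNy (y : sphere R n) : (-oo < legendre y)%E.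
Proof.
apply: lt_le_trans (_ : (dot 0 (set_val y) - u 0)%:E <= _)%E; first exact: ltNyr.
by apply: ereal_sup_ubound; exists 0.
Qed.

Lemma legendre_lsc : lower_semicontinuous legendre.
Proof.
move=> y a /ereal_sup_gt[_ [x _ <-]]; rewrite lte_fin => ax.
exists [set p : sphere R n | a < dot x (set_val p) - u x]; last first.
  move=> p /= ap; apply: lt_le_trans (_ : (dot x (set_val p) - u x)%:E <= _)%E.
    by rewrite lte_fin.
  by apply: ereal_sup_ubound; exists x.
have cf : {for y, continuous (fun p : sphere R n => dot x (set_val p))}.
  apply: (continuous_dot (f := cst x)); first exact: cst_continuous.
  exact: initial_continuous.
have d0 : 0 < dot x (set_val y) - u x - a by lra.
move/cvgrPdist_lt : cf => /(_ _ d0); apply: filterS => p /=.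
by rewrite ltr_norml => /andP[]; lra.
Qed.

Lemma finite_locus_support (y : sphere R n) : finite_locus legendre y <->
  exists x0 t0, null_support u x0 t0 (set_val y).
Proof.
split=> [|[x0 [t0 sup]]].
  rewrite /finite_locus/=; have := legendre_gtNy y.
  have := @legendre_le y.
  case: (legendre y) => [b h _ _|_ _|//]; last by rewrite ltxx.
  exists 0, (- b) => z; have [/(_ (lexx _))/(_ z) hz _] := h b.
  by rewrite subr0; lra.
rewrite /finite_locus/=; apply: le_lt_trans (ltry (dot x0 (set_val y) - t0)).
by apply/legendre_le => z; have := sup z; rewrite !dotE; lra.
Qed.

(** The supremum that defines the regular domain is attained, by compactness
    of the sphere: the points outside the domain are those through which a
    support hyperplane passes. *)
Lemma support_fun_legendre x0 (t0 : R) :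
  (t0%:E <= support_fun legendre x0)%E <->
  exists2 y, sphere R n y & null_support u x0 t0 y.
Proof.
split=> [h|[y sy sup]].
  apply: null_support_limit => r r0.
  have : ((t0 - r^-1)%:E < support_fun legendre x0)%E.
    by apply: lt_le_trans h; rewrite lte_fin ltrBlDr ltrDl invr_gt0.
  move=> /ereal_sup_gt[_ [y fy <-]] hy; exists (set_val y); first exact: set_valP.
  move=> z; move: hy fy; rewrite /finite_locus/=; have := legendre_gtNy y.
  have := @legendre_le y.
  case: (legendre y) => [b hb _|_ _ _|//]; last by rewrite ltxx.
  rewrite lte_fin => hy _; have [/(_ (lexx _))/(_ z) hz _] := hb b.
  have ww := dot_ge0 (z - x0); have r1 : 0 < r^-1 by rewrite invr_gt0.
  have := mulr_ge0 ww (ltW r1); rewrite mulrDl mul1r.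
  rewrite (dotDl z (- x0) (set_val y)) dotNl; lra.
pose Y : sphere R n := exist _ y (mem_set sy).
have lY : (legendre Y <= (dot x0 y - t0)%:E)%E.
  by apply/legendre_le => z; have := sup z; rewrite !dotE/=; lra.
apply: le_trans (ereal_sup_ubound _); last first.
  by exists Y => //; rewrite /finite_locus/=; apply: le_lt_trans lY (ltry _).
move: lY; rewrite /=; have := legendre_gtNy Y.
by case: (legendre Y) => [b _||//]//; rewrite !lee_fin; lra.
Qed.

Lemma nonvanishing_gt0 (H : R -> R) (s t : R) : continuous H ->
  (forall r, H r != 0) -> 0 < H s -> 0 < H t.
Proof.
move=> cH H0 Hs; rewrite ltNge le_eqVlt (negbTE (H0 t))/=; apply/negP => Ht.
have [st|/ltW ts] := leP s t.
  have [||c _ /eqP] := @IVT R H s t 0 st; last by rewrite (negbTE (H0 c)).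
    exact: continuous_subspaceT.
  by rewrite ge_min le_max (ltW Hs) (ltW Ht) orbT.
have [||c _ /eqP] := @IVT R H t s 0 ts; last by rewrite (negbTE (H0 c)).
  exact: continuous_subspaceT.
by rewrite ge_min le_max (ltW Hs) (ltW Ht) orbT.
Qed.

(** A point off the domain of dependence lies on a causal curve that stays on
    one side of the graph; escaping to infinity, the curve singles out a null
    hyperplane on that side. *)
Theorem domain_of_dependence_graph :
  (forall x0 t0 y, sphere R n y -> ~ null_support (fun x => - u x) x0 t0 y) ->
  domain_of_dependence (graph u) = regular_domain legendre.
Proof.
move=> noabove; apply/seteqP; split=> [[x0 t0] dep|[x0 t0] reg f cf [t1 [fx e1]]].
  rewrite /regular_domain/= ltNge; apply/negP => /support_fun_legendre[y sy sup].
  have [||s [z _ [zE sE]]] := dep (fun s => (x0 - t0 *: y) + s *: y).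
  - exact: causal_line.
  - by exists t0; rewrite subrK.
  have := null_support_strict z sy sup.
  by rewrite sE zE !dotE (sphere_dot sy); lra.
rewrite {}e1 in fx.
have nosup y : sphere R n y -> ~ null_support u x0 t0 y.
  move=> sy sup; move: reg; rewrite /regular_domain/= ltNge => /negP; apply.
  by apply/support_fun_legendre; exists y.
apply: contrapT => miss.
pose H s := u (f s) - s.
have cf' : continuous f by have [sf _] := cf; exact: smooth_continuous.
have cH : continuous H.
  move=> s; apply: (continuous_subf (f := u \o f) (g := id)) => //.
  by apply: continuous_comp; [exact: cf'|exact: smooth_continuous].
have H0 s : H s != 0.
  apply/eqP => /eqP; rewrite subr_eq0 => /eqP e; apply: miss; exists s.
  by exists (f s) => //; rewrite /graph_map e.
have [Hneg|Hpos] := ltP (H t0) 0.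
  have neg s : H s < 0.
    rewrite -oppr_gt0; apply: (@nonvanishing_gt0 (fun s => - H s) t0 s).
    - by move=> q; apply: continuousN; exact: cH.
    - by move=> q; rewrite oppr_eq0.
    - by rewrite oppr_gt0.
  have [|r|y sy] := @null_support_of_unbounded (fun x => - u x) x0 (- t0).
  - by move=> p q; rewrite opprK addrC -(enormN (p - q)) opprB lipschitz.
  - pose s := Num.min t0 (u x0 - r); exists (f s).
      have := lipschitz x0 (f s); rewrite -enormN opprB.
      have := neg s; rewrite /H; have : s <= u x0 - r by rewrite ge_min lexx orbT.
      lra.
    have st : s <= t0 by rewrite ge_min lexx.
    have := causal_lipschitz cf st; rewrite fx -enormN opprB.
    by have := neg s; rewrite /H; lra.
  exact: noabove.
have pos s : 0 < H s.
  by apply: (@nonvanishing_gt0 H t0 s) => //; rewrite lt_def H0.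
have [|r|y sy] := @null_support_of_unbounded u x0 t0.
- exact: lipschitz.
- pose s := Num.max t0 (r + u x0); exists (f s).
    have := lipschitz (f s) x0.
    have := pos s; rewrite /H; have : r + u x0 <= s by rewrite le_max lexx orbT.
    lra.
  have st : t0 <= s by rewrite le_max lexx.
  have := causal_lipschitz cf st; rewrite fx.
  by have := pos s; rewrite /H; lra.
exact: nosup.
Qed.

End Causality.

(** * The proper time to the graph *)

Section ThreeDirections.
Context {R : realType}.
Variables (u : 'rV[R]_3 -> R) (c : R).
Hypothesis smooth_u : smooth u.
Hypothesis spacelike_u : forall x, enorm (gradient u x) < 1.
Hypothesis c_gt0 : 0 < c.
Hypothesis curv_u : curvature_bound u c.
Implicit Types (x y z w : 'rV[R]_3).

Definition null_direction y : Prop :=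
  sphere R 3 y /\ exists x0 t0, null_support u x0 t0 y.

(** As in the singularity theorem of Hawking, the proper time from a point of
    the past domain of dependence to the graph is bounded in terms of the
    curvature: where it is maximal, a hyperboloid touches the graph. *)
Lemma proper_time2_bound y1 y2 x0 t0 z :
  sphere R 3 y1 -> sphere R 3 y2 -> y1 != y2 ->
  (forall y, sphere R 3 y -> ~ null_support u x0 t0 y) ->
  t0 + enorm (z - x0) <= u z -> c * proper_time2 u x0 t0 z <= 6.
Proof.
move=> sy1 sy2 y12 nosup Az.
have [tz|tz] := leP (proper_time2 u x0 t0 z) 0.
  by apply: le_trans (_ : 0 <= _) => //; rewrite pmulr_rle0.
pose A := [set p : 'rV[R]_3 | t0 + enorm (p - x0) <= u p].
have ccen : continuous (fun p : 'rV[R]_3 => enorm (p - x0)).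
  move=> p; apply: (continuous_enorm (f := fun p : 'rV[R]_3 => p - x0)).
  apply: (continuous_subf (f := id) (g := cst x0)); first by [].
  exact: cst_continuous.
pose G (p : 'rV[R]_3) := u p - (t0 + enorm (p - x0)).
have cG : continuous G.
  move=> p; apply: (continuous_subf (f := u) (g := fun p : 'rV[R]_3 => t0 + enorm (p - x0))).
    exact: smooth_continuous.
  apply: (continuous_addf (f := cst t0)); first exact: cst_continuous.
  exact: ccen.
have clA : closed A.
  rewrite (_ : A = G @^-1` [set r | 0 <= r]); last first.
    by apply/seteqP; split=> p; rewrite /A /G/= subr_ge0.
  apply: preimage_closed; last exact: closed_ge.
  by move=> p _; exact: cG.
have [r hr] : exists r, forall p, A p -> enorm (p - x0) <= r.
  apply: contrapT => nb.
  have [|r|y sy] := @null_support_of_unbounded R 3 u x0 t0.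
  - exact: lipschitz.
  - apply: contrapT => nr; apply: nb; exists r => p Ap.
    by rewrite leNgt; apply/negP => /ltW rp; apply: nr; exists p.
  exact: nosup.
have cA : compact A.
  apply: (@compact_enorm _ _ _ (r + enorm x0)) => // p /hr hp.
  rewrite -{1}(subrK x0 p); apply: le_trans (enormD _ _) _.
  by rewrite lerD2r.
have A0 : A !=set0 by exists z.
have ct : {within A, continuous (proper_time2 u x0 t0)}.
  by apply: continuous_subspaceT; exact: continuous_proper_time2.
have [z1 Az1 zmax] := EVT_max_rV A0 cA ct.
have {}zmax p : A p -> proper_time2 u x0 t0 p <= proper_time2 u x0 t0 z1.
  by move=> Ap; apply: zmax; rewrite inE.
rewrite inE in Az1.
have t1 : 0 < proper_time2 u x0 t0 z1 by apply: lt_le_trans tz (zmax _ Az).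
have strict : enorm (z1 - x0) < u z1 - t0.
  move: t1; rewrite /proper_time2 subr_gt0 -enorm_sqr => t1.
  have h0 : 0 <= u z1 - t0.
    by have := enorm_ge0 (z1 - x0); move: Az1; rewrite /A/=; lra.
  by rewrite -ltr_sqr ?nnegrE ?enorm_ge0.
have bE : barrier u y1 y2 x0 t0 1 = proper_time2 u x0 t0.
  by apply/funext => p; rewrite /barrier subrr !mul0r add0r mul1r.
have null_pos y : sphere R 3 y -> 0 < null_coord u x0 t0 y z1.
  move=> sy; rewrite /null_coord subr_gt0; apply: le_lt_trans strict.
  by apply: le_trans (dot_le_enorm _ _) _; rewrite [enorm y]sy mulr1.
have near : \forall p \near z1,
    barrier u y1 y2 x0 t0 1 p <= barrier u y1 y2 x0 t0 1 z1.
  have G1 : 0 < G z1 by rewrite /G; lra.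
  move/cvgrPdist_lt : (cG z1) => /(_ _ G1); rewrite bE; apply: filterS => p /=.
  rewrite ltr_norml => /andP[_ hG]; apply: zmax.
  by move: hG; rewrite /A/= /G; lra.
have h : c * barrier u y1 y2 x0 t0 1 z1 <= 6 * 1.
  apply: (barrier_max_le smooth_u spacelike_u sy1 sy2 y12 c_gt0 curv_u _ near).
  - by rewrite ltr01 lexx.
  - by rewrite bE.
  - exact: null_pos.
  - exact: null_pos.
rewrite bE mulr1 in h; apply: le_trans h.
by rewrite ler_pM2l//; exact: zmax.
Qed.

(** The function [z |-> u z - dot z y] decreases along [y], so it has no
    minimum: a null hyperplane just below a point of the graph crosses the graph
    elsewhere. *)
Lemma not_null_support z0 y : sphere R 3 y -> exists2 d : R, 0 < d &
  forall x0 t0, t0 - dot x0 y = u z0 - dot z0 y - d -> ~ null_support u x0 t0 y.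
Proof.
move=> sy.
have zy : z0 + y - z0 = y by rewrite addrC addKr.
have y0 : y != 0.
  by apply/eqP => y0; move: (sphere_dot sy); rewrite y0 dot0l; lra.
have zy0 : z0 + y != z0 by rewrite -subr_eq0 zy.
have := strict_lipschitz smooth_u spacelike_u zy0; rewrite zy [enorm y]sy => h.
exists ((1 - (u (z0 + y) - u z0)) / 2); first lra.
move=> x0 t0 e /(_ (z0 + y)); rewrite !dotE (sphere_dot sy).
by move: e; move: (dot x0 y) (dot z0 y) => p q; lra.
Qed.

Section TwoDirections.
Variables y1 y2 : 'rV[R]_3.
Hypotheses (sy1 : sphere R 3 y1) (sy2 : sphere R 3 y2) (y12 : y1 != y2).
Hypothesis only_y1_y2 : forall y, null_direction y -> y = y1 \/ y = y2.
Let d := null_gap y1 y2.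
Let d0 : 0 < d. Proof. exact: null_gap_gt0. Qed.
Let y12E : dot y1 y2 = 1 - d. Proof. by rewrite /d /null_gap; ring. Qed.

(** The proper time bound, for a point that is reached from the graph by going
    back along the two null directions. *)
Lemma null_translate_bound z0 (a b : R) : 0 <= a -> 0 <= b ->
  (forall x0 t0, t0 - dot x0 y1 = u z0 - dot z0 y1 - b * d ->
     ~ null_support u x0 t0 y1) ->
  (forall x0 t0, t0 - dot x0 y2 = u z0 - dot z0 y2 - a * d ->
     ~ null_support u x0 t0 y2) ->
  c * (2 * a * b * d) <= 6.
Proof.
move=> a0 b0 h1 h2.
pose v := a *: y1 + b *: y2; pose x0 := z0 - v; pose t0 := u z0 - (a + b).
have zx : z0 - x0 = v by rewrite /x0 opprB addrC subrK.
have x0E y : dot x0 y = dot z0 y - a * dot y1 y - b * dot y2 y.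
  by rewrite /x0 /v !dotE; ring.
have vv : dot v v = (a + b) ^+ 2 - 2 * a * b * d.
  rewrite /v !dotE (sphere_dot sy1) (sphere_dot sy2) (dotC y2 y1) y12E; ring.
have tE : proper_time2 u x0 t0 z0 = 2 * a * b * d.
  by rewrite /proper_time2 zx vv /t0; ring.
have d0' := d0.
have abd : 0 <= 2 * a * b * d by rewrite !mulr_ge0// ltW.
rewrite -tE; apply: (proper_time2_bound sy1 sy2 y12).
  move=> y sy sup; have [] := @only_y1_y2 y.
  - by split=> //; exists x0, t0.
  - move=> yE; rewrite {}yE in sup; apply: h1 sup.
    by rewrite x0E (sphere_dot sy1) (dotC y2 y1) y12E /t0; ring.
  - move=> yE; rewrite {}yE in sup; apply: h2 sup.
    by rewrite x0E (sphere_dot sy2) y12E /t0; ring.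
rewrite zx /t0; suff : enorm v <= a + b by lra.
rewrite enorm_leP ?addr_ge0// vv; lra.
Qed.

End TwoDirections.

(** If [y2] is not a null direction then going back along [y2] never leaves
    the past domain of dependence, and proper time to the graph is unbounded. *)
Lemma null_direction_of_only y1 y2 : sphere R 3 y1 -> sphere R 3 y2 ->
  y1 != y2 -> (forall y, null_direction y -> y = y1 \/ y = y2) ->
  null_direction y2.
Proof.
move=> sy1 sy2 y12 only; apply: contrapT => n2.
have d0 := null_gap_gt0 sy1 sy2 y12.
have [e e0 he] := not_null_support 0 sy1.
pose b := e / null_gap y1 y2.
have b0 : 0 < b by rewrite divr_gt0.
(* Any value above 6 in place of 7 contradicts the proper time bound. *)
pose a := 7 / (c * (2 * b * null_gap y1 y2)).
have den0 : 0 < c * (2 * b * null_gap y1 y2).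
  by apply: mulr_gt0 => //; apply: mulr_gt0 => //; lra.
have a0 : 0 <= a by apply: divr_ge0; [lra|exact: ltW].
have bE : b * null_gap y1 y2 = e by rewrite /b divfK// lt0r_neq0.
have := @null_translate_bound _ _ sy1 sy2 y12 only 0 a b a0 (ltW b0).
rewrite bE => /(_ he) h.
have {h} : c * (2 * a * b * null_gap y1 y2) <= 6.
  by apply: h => x0 t0 _ sup; apply: n2; split=> //; exists x0, t0.
have -> : c * (2 * a * b * null_gap y1 y2) = 7.
  rewrite /a; field.
  by rewrite (lt0r_neq0 c_gt0) (lt0r_neq0 d0) (lt0r_neq0 b0).
lra.
Qed.

(** The height of the highest null hyperplane [t = dot z y + h] below the graph,
    when [y] is a null direction; otherwise the set is not bounded below. *)
Definition null_height y : R := inf [set u z - dot z y | z in [set: 'rV[R]_3]].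

Lemma null_heightP y : null_direction y -> forall x0 t0,
  null_support u x0 t0 y <-> t0 - dot x0 y <= null_height y.
Proof.
move=> [sy [x1 [t1 sup1]]].
have hinf : has_inf [set u z - dot z y | z in [set: 'rV[R]_3]].
  split; first by exists (u 0 - dot 0 y); exists 0.
  exists (t1 - dot x1 y) => _ [z _ <-]; have := sup1 z; rewrite !dotE.
  by move: (dot x1 y) (dot z y) => p q; lra.
move=> x0 t0; split=> [sup|h z].
  apply: lb_le_inf; first by have [] := hinf.
  move=> _ [z _ <-]; have := sup z; rewrite !dotE.
  by move: (dot x0 y) (dot z y) => p q; lra.
have [_ hlb] := hinf.
have : null_height y <= u z - dot z y by apply: ge_inf => //; exists z.
by move: h; rewrite !dotE; move: (dot x0 y) (dot z y) => p q; lra.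
Qed.

Lemma null_height_lt y z : null_direction y -> null_height y < u z - dot z y.
Proof.
move=> dy; have [sy _] := dy; have P := null_heightP dy.
have [|] := ltP (null_height y) (u z - dot z y) => // h.
have /P sup : u z - dot z y <= null_height y by [].
have := null_support_strict smooth_u spacelike_u z sy sup.
by rewrite subrr dot0l addr0 ltxx.
Qed.

End ThreeDirections.

(** * Three null directions *)

Section NotTwoDirections.
Context {R : realType}.
Variables (u : 'rV[R]_3 -> R) (c : R).
Hypothesis smooth_u : smooth u.
Hypothesis spacelike_u : forall x, enorm (gradient u x) < 1.
Hypothesis c_gt0 : 0 < c.
Hypothesis curv_u : curvature_bound u c.
Implicit Types (x y z w p : 'rV[R]_3).

(** When both null coordinates are bounded, [t] grows at most like [k * |w|]
    with [k < 1], because [(y1 + y2) / 2] lies inside the unit ball. A lower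
    bound on the proper time then bounds [w]. *)
Lemma bounded_of_null_coords (y1 y2 w : 'rV[R]_3) (t L B : R) :
  sphere R 3 y1 -> sphere R 3 y2 -> y1 != y2 ->
  0 <= t - dot w y1 <= L -> 0 <= t - dot w y2 <= L ->
  - B <= t ^+ 2 - dot w w ->
  null_gap y1 y2 * dot w w <=
    (2 * L) ^+ 2 * (1 + 4 / null_gap y1 y2) + 4 * B.
Proof.
move=> sy1 sy2 y12 h1 h2 hB.
have d0 := null_gap_gt0 sy1 sy2 y12.
have y12E : dot y1 y2 = 1 - null_gap y1 y2 by rewrite /null_gap; ring.
have := dot_cauchy_schwarz w (y1 + y2); have := dot_ge0 w.
have -> : dot (y1 + y2) (y1 + y2) = 4 - 2 * null_gap y1 y2.
  by rewrite !dotE (sphere_dot sy1) (sphere_dot sy2) (dotC y2 y1) y12E; ring.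
rewrite dotDr; move: (null_gap y1 y2) d0 (dot w w) (dot w y1) (dot w y2) h1 h2 hB.
move=> d d0 q p1 p2 h1 h2 hB q0 cs.
pose s := (t - p1) + (t - p2); pose g := p1 + p2.
have tE : 2 * t = s + g by rewrite /s /g; ring.
have s2 : s ^+ 2 <= (2 * L) ^+ 2 by rewrite ler_sqr ?nnegrE /s; lra.
have amgm : 2 * s * g <= s ^+ 2 * (4 / d) + g ^+ 2 * (d / 4).
  rewrite -subr_ge0.
  have -> : s ^+ 2 * (4 / d) + g ^+ 2 * (d / 4) - 2 * s * g =
     (s * 4 - g * d) ^+ 2 / (4 * d) by field; exact: lt0r_neq0.
  by rewrite divr_ge0 ?sqr_ge0//; lra.
have t2 : 4 * t ^+ 2 <= s ^+ 2 * (1 + 4 / d) + g ^+ 2 * (1 + d / 4).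
  have -> : 4 * t ^+ 2 = (2 * t) ^+ 2 by ring.
  by rewrite tE; lra.
have g2 : g ^+ 2 * (1 + d / 4) <= q * (4 - 2 * d) * (1 + d / 4).
  by rewrite ler_wpM2r//; lra.
have s2' : s ^+ 2 * (1 + 4 / d) <= (2 * L) ^+ 2 * (1 + 4 / d).
  by rewrite ler_wpM2r// addr_ge0// divr_ge0// ltW.
have qd : 0 <= q * d ^+ 2 by rewrite mulr_ge0// sqr_ge0.
lra.
Qed.

Section Wedge.
Variables y1 y2 : 'rV[R]_3.
Hypotheses (sy1 : sphere R 3 y1) (sy2 : sphere R 3 y2) (y12 : y1 != y2).
Hypothesis only_y1_y2 : forall y, null_direction u y -> y = y1 \/ y = y2.
Hypotheses (dir1 : null_direction u y1) (dir2 : null_direction u y2).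
Let d := null_gap y1 y2.
Let d0 : 0 < d. Proof. exact: null_gap_gt0. Qed.
Let y12E : dot y1 y2 = 1 - d. Proof. by rewrite /d /null_gap; ring. Qed.
Let gap y z := u z - dot z y - null_height u y.

Let gap1_gt0 z : 0 < gap y1 z.
Proof. by rewrite subr_gt0; exact: null_height_lt. Qed.
Let gap2_gt0 z : 0 < gap y2 z.
Proof. by rewrite subr_gt0; exact: null_height_lt. Qed.

(** Up to a constant factor, the product of the gaps is the squared proper time
    from the edge of the wedge. The bound on proper time applies to the points
    inside the wedge, in particular to the midpoint between the edge and the
    point of the graph. *)
Lemma gap_product_bound z : c * (gap y1 z * gap y2 z) <= 12 * d.
Proof.
have d0' := lt0r_neq0 d0.
have g1 := gap1_gt0 z; have g2 := gap2_gt0 z.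
pose a := gap y2 z / (2 * d); pose b := gap y1 z / (2 * d).
have a0 : 0 <= a by rewrite divr_ge0//; [exact: ltW|rewrite mulr_ge0// ltW].
have b0 : 0 <= b by rewrite divr_ge0//; [exact: ltW|rewrite mulr_ge0// ltW].
have aE : a * d = gap y2 z / 2 by rewrite /a; field.
have bE : b * d = gap y1 z / 2 by rewrite /b; field.
have := @null_translate_bound _ _ _ smooth_u spacelike_u c_gt0 curv_u _ _
  sy1 sy2 y12 only_y1_y2 z a b a0 b0.
rewrite -/d aE bE => h.
have {h} : c * (2 * a * b * d) <= 6.
  apply: h => x0 t0 e /null_heightP.
    by move=> /(_ dir1); rewrite e; rewrite /gap in g1 *; lra.
  by move=> /(_ dir2); rewrite e; rewrite /gap in g2 *; lra.
have -> : c * (2 * a * b * d) = c * (gap y1 z * gap y2 z) / (2 * d).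
  by rewrite /a /b; field.
by rewrite ler_pdivrMr; [lra|rewrite mulr_gt0].
Qed.

(** When the domain is a wedge, a stretched hyperboloid whose centre lies
    slightly inside the wedge touches the graph from above. As the stretching
    parameter goes to zero its second symmetric function of curvatures also
    does, and becomes smaller than that of the graph. *)
Lemma no_wedge : False.
Proof.
have d0' := lt0r_neq0 d0.
pose s := Num.min (gap y1 0) (gap y2 0) / 2.
have s0 : 0 < s by rewrite divr_gt0// lt_min gap1_gt0 gap2_gt0.
have s1 : s < gap y1 0.
  by rewrite ltr_pdivrMr// gt_min; apply/orP; left; have := gap1_gt0 0; lra.
have s2 : s < gap y2 0.
  by rewrite ltr_pdivrMr// gt_min; apply/orP; right; have := gap2_gt0 0; lra.
(* The centre of the quadric: the point whose two null coordinates exceed those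
   of the edge of the wedge by [s]. *)
pose b := (null_height u y1 + s) / d; pose a := (null_height u y2 + s) / d.
pose x0 := a *: y1 + b *: y2; pose t0 := a + b.
have n1E z : null_coord u x0 t0 y1 z = gap y1 z - s.
  rewrite /null_coord dotDl dotNl /x0 dotDl !dotZl (sphere_dot sy1).
  by rewrite (dotC y2 y1) y12E /t0 /gap /a /b; move: (dot z y1) => r; field.
have n2E z : null_coord u x0 t0 y2 z = gap y2 z - s.
  rewrite /null_coord dotDl dotNl /x0 dotDl !dotZl (sphere_dot sy2).
  by rewrite y12E /t0 /gap /a /b; move: (dot z y2) => r; field.
clearbody x0 t0.
pose P0 := 2 / d * ((gap y1 0 - s) * (gap y2 0 - s)).
have P00 : 0 < P0 by rewrite mulr_gt0 ?divr_gt0// mulr_gt0 ?subr_gt0.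
pose Q0 := proper_time2 u x0 t0 0.
(* The barrier at 0 tends to [P0] as [e] tends to zero: [e] is such that it is
   still at least [P0 / 2], while [6 * e / c] is less than [P0 / 2]. *)
have [e [e0 e1 eP eC]] : exists e : R,
    [/\ 0 < e, e <= 1, 2 * e * (P0 + `|Q0|) <= P0 & 13 * e <= c * P0].
  have PQ : 0 < P0 + `|Q0| by rewrite ltr_pwDl.
  pose e := Num.min 1 (Num.min (P0 / (2 * (P0 + `|Q0|))) (c * P0 / 13)).
  have PQ2 : 0 < 2 * (P0 + `|Q0|) by rewrite mulr_gt0.
  exists e; split.
  - by rewrite !lt_min ltr01 !divr_gt0// mulr_gt0.
  - by rewrite ge_min lexx.
  - have : e <= P0 / (2 * (P0 + `|Q0|)) by rewrite !ge_min lexx orbT.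
    by rewrite ler_pdivlMr//; lra.
  - have : e <= c * P0 / 13 by rewrite !ge_min lexx !orbT.
    lra.
pose F := barrier u y1 y2 x0 t0 e.
have F0 : P0 / 2 <= F 0.
  rewrite /F barrier_cone n1E n2E -/d -/P0 -/Q0.
  have h1 := ler_norm (- Q0); rewrite normrN in h1.
  have := ler_wpM2l (ltW e0) h1; lra.
have FP z : F z <= 2 / d * ((gap y1 z - s) * (gap y2 z - s)).
  by have := barrier_le u x0 t0 sy1 sy2 y12 z (ltW e0); rewrite n1E n2E.
pose A := [set z | [/\ s <= gap y1 z, s <= gap y2 z & P0 / 2 <= F z]].
have cn y : continuous (null_coord u x0 t0 y) by exact: continuous_null_coord.
have cF : continuous F by exact: continuous_barrier.
have clA : closed A.
  rewrite (_ : A = null_coord u x0 t0 y1 @^-1` [set r | 0 <= r] `&`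
     (null_coord u x0 t0 y2 @^-1` [set r | 0 <= r] `&`
      F @^-1` [set r | P0 / 2 <= r])); last first.
    apply/seteqP; split=> z; rewrite /A/= n1E n2E !subr_ge0; first by case.
    by move=> [? [? ?]]; split.
  apply: closedI; first by apply: preimage_closed; [move=> z _; exact: cn
                                                   |exact: closed_ge].
  apply: closedI; first by apply: preimage_closed; [move=> z _; exact: cn
                                                   |exact: closed_ge].
  by apply: preimage_closed; [move=> z _; exact: cF|exact: closed_ge].
pose L := 12 * d / (c * s); pose B := 24 / c / e.
pose M := (2 * L) ^+ 2 * (1 + 4 / d) + 4 * B.
have cs0 : 0 < c * s by rewrite mulr_gt0.
have bA z : A z -> d * dot (z - x0) (z - x0) <= M.
  move=> [Az1 Az2 AF]; have gp := gap_product_bound z.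
  have g1 := gap1_gt0 z; have g2 := gap2_gt0 z.
  apply: (@bounded_of_null_coords y1 y2 (z - x0) (u z - t0)) => //.
  - rewrite -/(null_coord u x0 t0 y1 z) n1E subr_ge0 Az1/=.
    apply: le_trans (_ : gap y1 z <= _); first lra.
    rewrite ler_pdivlMr//; apply: le_trans gp; rewrite mulrCA ler_pM2l//.
    by rewrite ler_pM2l.
  - rewrite -/(null_coord u x0 t0 y2 z) n2E subr_ge0 Az2/=.
    apply: le_trans (_ : gap y2 z <= _); first lra.
    rewrite ler_pdivlMr//; apply: le_trans gp; rewrite mulrCA ler_pM2l//.
    by rewrite mulrC ler_pM2r.
  - rewrite -/(proper_time2 u x0 t0 z).
    have Fz : 0 <= F z by apply: le_trans AF; rewrite divr_ge0// ltW.
    rewrite /F barrier_cone n1E n2E -/d in Fz.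
    have h : (gap y1 z - s) * (gap y2 z - s) <= gap y1 z * gap y2 z.
      by apply: ler_pM; rewrite ?subr_ge0// lerBlDr lerDl ltW.
    have k0 : 0 <= (gap y1 z - s) * (gap y2 z - s) by rewrite mulr_ge0 ?subr_ge0.
    have k : 2 / d * ((gap y1 z - s) * (gap y2 z - s)) <= 24 / c.
      rewrite ler_pdivlMr// mulrC -(ler_pM2r d0).
      have -> : c * (2 / d * ((gap y1 z - s) * (gap y2 z - s))) * d =
         2 * (c * ((gap y1 z - s) * (gap y2 z - s))) by field.
      have := ler_wpM2l (ltW c_gt0) h; lra.
    have k1 : 0 <= 2 / d * ((gap y1 z - s) * (gap y2 z - s)).
      by rewrite mulr_ge0// divr_ge0// ltW.
    have ek := mulr_ge0 (ltW e0) k1.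
    rewrite /B lerNl ler_pdivlMr//; lra.
have cA : compact A.
  apply: (@compact_enorm _ _ _ (1 + M / d + enorm x0)) => // z /bA hz.
  rewrite -{1}(subrK x0 z); apply: le_trans (enormD _ _) _; rewrite lerD2r.
  have : dot (z - x0) (z - x0) <= M / d by rewrite ler_pdivlMr// mulrC.
  rewrite -enorm_sqr; have := enorm_ge0 (z - x0).
  by move: (enorm _) (M / d) => r q r0 rq; nra.
have A0 : A !=set0 by exists 0; split=> //; exact: ltW.
have ct : {within A, continuous F} by exact: continuous_subspaceT.
have [z1 + zmax] := EVT_max_rV A0 cA ct; rewrite inE => -[Az1 Az2 AF].
have Fpos : 0 < F z1 by apply: lt_le_trans AF; rewrite divr_gt0.
have prod0 : 0 < (gap y1 z1 - s) * (gap y2 z1 - s).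
  have := lt_le_trans Fpos (FP z1).
  by rewrite pmulr_rgt0// divr_gt0.
have pos1 : 0 < gap y1 z1 - s.
  rewrite lt_def subr_ge0 Az1 andbT; apply/eqP => h.
  by move: prod0; rewrite h mul0r ltxx.
have pos2 : 0 < gap y2 z1 - s.
  rewrite lt_def subr_ge0 Az2 andbT; apply/eqP => h.
  by move: prod0; rewrite h mulr0 ltxx.
have near : \forall p \near z1, F p <= F z1.
  have near_pos y : 0 < null_coord u x0 t0 y z1 ->
      \forall p \near z1, 0 < null_coord u x0 t0 y p.
    move=> n0; move/cvgrPdist_lt : (cn y z1) => /(_ _ n0); apply: filterS => p.
    by rewrite ltr_norml => /andP[]; lra.
  have N1 := near_pos y1; rewrite n1E in N1.
  have N2 := near_pos y2; rewrite n2E in N2.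
  have N12 : \forall p \near z1,
      0 < null_coord u x0 t0 y1 p /\ 0 < null_coord u x0 t0 y2 p.
    exact: (filterI (N1 pos1) (N2 pos2)).
  apply: filterS N12 => p [].
  rewrite n1E n2E !subr_gt0 => p1 p2.
  have [Fp|/ltW Fp] := leP (P0 / 2) (F p); last exact: le_trans Fp AF.
  by apply: zmax; rewrite inE; split=> //; exact: ltW.
have : c * F z1 <= 6 * e.
  apply: (barrier_max_le smooth_u spacelike_u sy1 sy2 y12 c_gt0 curv_u _ near) => //.
  - by rewrite e0 e1.
  - by rewrite n1E.
  - by rewrite n2E.
have := ler_wpM2l (ltW c_gt0) AF; lra.
Qed.

End Wedge.

Lemma null_direction_third y1 y2 : sphere R 3 y1 -> sphere R 3 y2 -> y1 != y2 ->
  exists y, [/\ null_direction u y, y != y1 & y != y2].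
Proof.
move=> sy1 sy2 y12; apply: contrapT => no3.
have only y : null_direction u y -> y = y1 \/ y = y2.
  move=> dy; have [->|n1] := eqVneq y y1; first by left.
  have [->|n2] := eqVneq y y2; first by right.
  by exfalso; apply: no3; exists y.
have dir2 := null_direction_of_only smooth_u spacelike_u c_gt0 curv_u
  sy1 sy2 y12 only.
have y21 : y2 != y1 by rewrite eq_sym.
have dir1 := null_direction_of_only smooth_u spacelike_u c_gt0 curv_u
  sy2 sy1 y21 (fun y h => iffLR (or_comm _ _) (only y h)).
exact: (no_wedge sy1 sy2 y12 only dir1 dir2).
Qed.

(** Any pair of directions misses some null direction; starting from an
    arbitrary pair, three steps collect three null directions. *)
Lemma three_null_directions : exists y1 y2 y3,
  [/\ null_direction u y1, null_direction u y2, null_direction u y3 &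
  [/\ y1 != y2, y1 != y3 & y2 != y3]].
Proof.
have sN y : sphere R 3 y -> sphere R 3 (- y) by rewrite /sphere/= enormN.
have neqN y : sphere R 3 y -> y != - y.
  move=> /sphere_dot yy; apply/eqP => e.
  by move: (yy); rewrite {1}e dotNl yy; lra.
have se : sphere R 3 ('e_0).
  by rewrite /sphere/= /enorm dot_delta eqxx sqrtr1.
have [y1 [d1 _ _]] := null_direction_third se (sN _ se) (neqN _ se).
have [s1 _] := d1.
have [y2 [d2 n21 _]] := null_direction_third s1 (sN _ s1) (neqN _ s1).
have [s2 _] := d2; have n12 : y1 != y2 by rewrite eq_sym.
have [y3 [d3 n31 n32]] := null_direction_third s1 s2 n12.
by exists y1, y2, y3; split=> //; split=> //; rewrite eq_sym.
Qed.

(** Two null hyperplanes of different directions cross, so a null hyperplane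
    above the graph is parallel to every null hyperplane below it. *)
Lemma no_null_hyperplane_above x0 (t0 : R) y : sphere R 3 y ->
  ~ null_support (fun x => - u x) x0 t0 y.
Proof.
move=> sy above.
have [y' [[sy' [x1 [t1 below]]] ny _]] : exists y', [/\ null_direction u y',
    y' != - y & y' != y].
  apply: null_direction_third => //; first by rewrite /sphere/= enormN.
  apply/eqP => e; have := sphere_dot sy; rewrite -{1}e dotNl (sphere_dot sy); lra.
pose w := y + y'.
have w0 : 0 < dot w w by apply: dot_gt0; rewrite /w addrC -[X in _ + X]opprK subr_eq0.
pose k := t0 + t1 - dot x0 y - dot x1 y'.
have bound z : k + dot z w <= 0.
  have := above z; have := below z; rewrite /k /w !dotE.
  by move: (dot z y) (dot z y') (dot x0 y) (dot x1 y') => a b a' b'; lra.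
have := bound ((1 - k) / dot w w *: w); rewrite dotZl divfK ?lt0r_neq0//.
by lra.
Qed.

End NotTwoDirections.

(** * Time orientation and conclusion *)

Section TimeReversal.
Context {R : realType} {n : nat}.

Definition time_reversal (p : mink_space R n) : mink_space R n := (p.1, - p.2).

Lemma time_reversal_diff p : differentiable time_reversal p /\
  forall v, 'D_v time_reversal p = time_reversal v.
Proof.
pose f1 : mink_space R n -> 'rV[R]_n := fst.
pose f2 : mink_space R n -> R := snd.
have c1 : continuous f1 by move=> q; exact: cvg_fst.
have c2 : continuous f2 by move=> q; exact: cvg_snd.
have d1 : differentiable f1 p by exact: (@linear_differentiable _ _ _ fst).
have d2 : differentiable f2 p by exact: (@linear_differentiable _ _ _ snd).
have d2N : differentiable (- f2) p by exact: differentiableN.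
have dp : differentiable (fun q => (f1 q, (- f2) q)) p.
  exact: differentiable_pair.
split=> // v.
rewrite (deriveE v dp) diff_pair// diffN//.
by rewrite /f1 /f2 (@diff_lin _ _ _ fst)// (@diff_lin _ _ _ snd).
Qed.

Lemma time_reversal_smooth : smooth time_reversal.
Proof.
apply: smooth_affine => [p|v]; first by have [] := time_reversal_diff p.
by exists (time_reversal v) => p; have [_ ->] := time_reversal_diff p.
Qed.

Lemma time_reversalK : involutive time_reversal.
Proof. by case=> x t; rewrite /time_reversal/= opprK. Qed.

Lemma time_reversal_isometry : mink_isometry time_reversal.
Proof.
split; first exact: time_reversal_smooth.
  by exists time_reversal; split;
    [exact: time_reversal_smooth|exact: time_reversalK|exact: time_reversalK].
move=> p v w; have [_ D] := time_reversal_diff p.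
by rewrite !D /mink/= mulrNN.
Qed.

Lemma time_reversal_reversing : time_reversing time_reversal.
Proof.
move=> p v _ v0; have [_ ->] := time_reversal_diff p.
by rewrite /= oppr_lt0.
Qed.

Lemma graph_time_reversal (u : 'rV[R]_n -> R) :
  graph (fun x => - u x) = time_reversal @` graph u.
Proof.
apply/seteqP; split=> [_ [x _ <-]|_ [_ [x _ <-] <-]]; last by exists x.
by exists (graph_map u x) => //; exists x.
Qed.

End TimeReversal.

Section Orientation.
Context {R : realType}.
Variable u : 'rV[R]_3 -> R.
Hypothesis smooth_u : smooth u.
Hypothesis spacelike_u : forall x, enorm (gradient u x) < 1.
Implicit Types x : 'rV[R]_3.

Lemma continuous_tr_shape :
  continuous (fun x => \tr (cometric u x *m hess u x)).
Proof.
have cp i : continuous (partial i u) by exact/smooth_continuous/smooth_partial.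
have ch i j : continuous (hess_entry u i j).
  exact/smooth_continuous/smooth_hess_entry.
have cl : continuous (lapse2 u).
  rewrite (_ : lapse2 u = fun x => 1 - \sum_i partial i u x * partial i u x).
    move=> x; apply: (continuous_subf (f := fun _ : 'rV[R]_3 => 1 : R)
      (g := fun x => \sum_i partial i u x * partial i u x)).
      exact: cst_continuous.
    by apply: continuous_sum => i; apply: continuous_mulf; exact: cp.
  apply/funext => x; rewrite /lapse2 /dot; congr (1 - _).
  by apply: eq_bigr => i _; rewrite !mxE.
have cg i : continuous (hess_grad u i).
  move=> x; apply: (continuous_sum (F := fun m x => hess_entry u i m x * partial m u x)).
  by move=> m; apply: continuous_mulf; [exact: ch|exact: cp].
rewrite (_ : (fun x => _) = fun x => \sum_i hess_entry u i i x +
    (lapse2 u x)^-1 * \sum_i partial i u x * hess_grad u i x); last first.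
  by apply/funext => x; exact: tr_shape.
move=> x; apply: (continuous_addf (f := fun x => \sum_i hess_entry u i i x)
  (g := fun x => (lapse2 u x)^-1 * \sum_i partial i u x * hess_grad u i x)).
  by apply: continuous_sum => i; exact: ch.
apply: (continuous_mulf (f := fun x => (lapse2 u x)^-1)
  (g := fun x => \sum_i partial i u x * hess_grad u i x)).
  by apply: continuousV; [exact/lt0r_neq0/lapse2_gt0|exact: cl].
by apply: continuous_sum => i; apply: continuous_mulf; [exact: cp|exact: cg].
Qed.

Lemma hess_entryN i j x : hess_entry (fun x => - u x) i j x = - hess_entry u i j x.
Proof.
have pN k : partial k (fun x => - u x) = fun x => - partial k u x.
  apply/funext => y.
  by rewrite /partial; apply: (deriveN (smooth_derivable smooth_u)).
rewrite /hess_entry pN; apply: (deriveN (smooth_derivable _)).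
exact: smooth_partial.
Qed.

Lemma gradientN x : gradient (fun x => - u x) x = - gradient u x.
Proof.
apply/rowP => i; rewrite !mxE.
exact: (deriveN (smooth_derivable smooth_u)).
Qed.

Lemma lapse2N x : lapse2 (fun x => - u x) x = lapse2 u x.
Proof. by rewrite /lapse2 gradientN !dotE opprK. Qed.

Lemma cometricN x : cometric (fun x => - u x) x = cometric u x.
Proof.
have trN (a : 'rV[R]_3) : (- a)^T = - a^T by apply/matrixP => i j; rewrite !mxE.
by rewrite /cometric lapse2N gradientN trN mulNmx mulmxN opprK.
Qed.

Lemma hessN x : hess (fun x => - u x) x = - hess u x.
Proof. by apply/matrixP => i j; rewrite !mxE hess_entryN. Qed.

(** Since the second symmetric function of the curvatures does not vanish, the
    mean curvature does not either, and it has a constant sign. *)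
Lemma curvature_bound_or_opp (c : R) : 0 < c ->
  (forall x, scalar_curvature (induced_metric u) x <= - c) ->
  curvature_bound u c \/ curvature_bound (fun x => - u x) c.
Proof.
move=> c0 hc.
have bound x : c * lapse2 u x <= \tr (cometric u x *m hess u x) ^+ 2
     - \tr (cometric u x *m hess u x *m (cometric u x *m hess u x)).
  have l0 := lapse2_gt0 spacelike_u x.
  have := hc x; rewrite scalar_curvature_graph// ler_pdivrMr//.
  by rewrite mulNr lerN2.
have tr0 x : \tr (cometric u x *m hess u x) != 0.
  apply/eqP => t0; have := bound x; rewrite t0 expr0n/= sub0r.
  have := tr_shape_sqr_ge0 smooth_u spacelike_u x.
  by have := mulr_gt0 c0 (lapse2_gt0 spacelike_u x); lra.
have same (e : R) x : e * e = 1 -> 0 < e * \tr (cometric u 0 *m hess u 0) ->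
    0 < e * \tr (cometric u x *m hess u x).
  move=> ee h0.
  pose H s := e * \tr (cometric u (0 + s *: x) *m hess u (0 + s *: x)).
  have H1 : H 1 = e * \tr (cometric u x *m hess u x).
    by rewrite /H scale1r add0r.
  rewrite -H1; apply: (@nonvanishing_gt0 _ H 0 1).
  - move=> s; apply: (continuous_mulf (f := fun _ : R => e)
      (g := fun s : R => \tr (cometric u (0 + s *: x) *m hess u (0 + s *: x)))).
      exact: cst_continuous.
    apply: (@continuous_comp _ _ _ (fun s : R => 0 + s *: x)
      (fun y => \tr (cometric u y *m hess u y))).
      exact: continuous_line.
    exact: continuous_tr_shape.
  - move=> s; apply: mulf_neq0; [apply/eqP => e0|exact: tr0].
    by move/eqP: ee; rewrite e0 mul0r eq_sym oner_eq0.
  - by rewrite /H scale0r addr0.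
have [tneg|tpos] := ltP (\tr (cometric u 0 *m hess u 0)) 0.
  right => x; rewrite cometricN hessN lapse2N mulmxN linearN/= sqrrN.
  rewrite mulNmx mulmxN opprK; split; last exact: bound.
  by rewrite -mulN1r; apply: same; rewrite ?mulrNN ?mulr1// mulN1r oppr_gt0.
left => x; split; last exact: bound.
by rewrite -[ltRHS]mul1r; apply: same; [exact: mulr1|rewrite mul1r lt_def tr0].
Qed.

End Orientation.

Lemma three_le_card (T : Type) (A : set T) (a b c : T) :
  A a -> A b -> A c -> a <> b -> a <> c -> b <> c -> `I_3 #<= A.
Proof.
move=> Aa Ab Ac ab ac bc.
pose f (i : nat) := if i is 0%N then a else if i is 1%N then b else c.
have fi : {in `I_3 &, injective f}.
  move=> i j; rewrite !inE/=; case: i => [|[|[|//]]] _;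
    by case: j => [|[|[|//]]] _ //= e; exfalso; apply/(_ : False); auto.
have /card_eqPle[_ h] := inj_card_eq fi.
apply: card_le_trans h _; apply: subset_card_le => _ [i _ <-].
by case: i => [|[|i]].
Qed.

Lemma future_regular_domain (R : realType) (u : 'rV[R]_3 -> R) (c : R) :
  entire_spacelike u -> 0 < c -> curvature_bound u c ->
  exists phi : sphere R 3 -> \bar R,
    [/\ lower_semicontinuous phi,
        forall y, (-oo < phi y)%E,
        domain_of_dependence (graph u) = regular_domain phi
      & `I_3 #<= finite_locus phi].
Proof.
move=> [smooth_u spacelike_u] c0 hc; exists (legendre u); split.
- exact: legendre_lsc.
- exact: legendre_gtNy.
- apply: domain_of_dependence_graph => // x0 t0 y sy.
  exact: (no_null_hyperplane_above smooth_u spacelike_u c0 hc).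
have [y1 [y2 [y3 [d1 d2 d3 [n12 n13 n23]]]]] :=
  three_null_directions smooth_u spacelike_u c0 hc.
have fin y (dy : null_direction u y) : exists2 Y : sphere R 3,
    set_val Y = y & finite_locus (legendre u) Y.
  have [sy sup] := dy.
  exists (exist _ y (mem_set sy)) => //.
  by apply/finite_locus_support.
have [Y1 E1 F1] := fin _ d1; have [Y2 E2 F2] := fin _ d2.
have [Y3 E3 F3] := fin _ d3.
apply: (three_le_card F1 F2 F3) => e.
- by move: n12; rewrite -E1 -E2 e eqxx.
- by move: n13; rewrite -E1 -E3 e eqxx.
- by move: n23; rewrite -E2 -E3 e eqxx.
Qed.

Theorem theorem1p5 (R : realType) (u : 'rV[R]_3 -> R)
    (spacelike_u : entire_spacelike u)
    (curv_u : exists c : R, c < 0 /\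
       forall x, scalar_curvature (induced_metric u) x <= c) :
  exists Sigma : set (mink_space R 3),
    (Sigma = graph u \/
     exists Phi : mink_space R 3 -> mink_space R 3,
       [/\ mink_isometry Phi, time_reversing Phi & Sigma = Phi @` graph u]) /\
    exists phi : sphere R 3 -> \bar R,
      [/\ lower_semicontinuous phi,
          forall y, (-oo < phi y)%E,
          domain_of_dependence Sigma = regular_domain phi
        & `I_3 #<= finite_locus phi].
Proof.
have [c [c0 hc]] := curv_u; have [smooth_u grad_u] := spacelike_u.
have nc0 : 0 < - c by rewrite oppr_gt0.
have [|H|H] := curvature_bound_or_opp smooth_u grad_u nc0.
- by move=> x; rewrite opprK.
- exists (graph u); split; first by left.
  exact: future_regular_domain nc0 H.
exists (graph (fun x => - u x)); split.
  right; exists time_reversal; split; [exact: time_reversal_isometry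
    |exact: time_reversal_reversing|exact: graph_time_reversal].
apply: future_regular_domain nc0 H; split; first exact: smoothN.
by move=> x; rewrite gradientN// enormN.
Qed.
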